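(* There exists a group $G$ of size $\aleph_1$ such that $\mathcal{FM}(G)$ is discrete, but $\mathfrak{Z}^{\pm}(G)$ is not discrete.
   Context: The statement is a theorem of ZFC. A topology $\tau$ on a semigroup $S$ is a semigroup topology if the semigroup operation $S\times S\to S$ is continuous with respect to $\tau$. The semigroup Fréchet–Markov topology $\mathcal{FM}(S)$ is the intersection of all $T_1$ semigroup topologies on $S$. (For a group $G$, $\mathcal{FM}(G)$ is that of $G$ regarded as a semigroup; continuity of inversion is not required.) For a group $G$, a function $f:G\to G$ is a group polynomial of degree $n$ if $(x)f=a_0x^{\varepsilon_1}a_1\cdots x^{\varepsilon_n}a_n$ for some $a_0,\ldots,a_n\in G$ and $\varepsilon_1,\ldots,\varepsilon_n\in\{-1,1\}$; constant functions are group polynomials of degree $0$. (The value of $f$ at $x$ is written $(x)f$.) The group Zariski topology $\mathfrak{Z}^{\pm}(G)$ is the topology on $G$ generated (as a subbase) by the sets $\{x\in G:(x)f\neq 1_G\}$, where $f$ is a group polynomial. *)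

(* Defs.v *)
From HB Require Import structures.
From mathcomp Require Import all_boot.
From mathcomp Require Import all_classical topology.
From mathcomp Require Import wochoice.

Set Implicit Arguments.
Unset Strict Implicit.
Unset Printing Implicit Defensive.

Local Open Scope classical_set_scope.
Local Open Scope group_scope.

(* [T] is in bijection with omega_1, the least uncountable ordinal: [T] has a
   well-order which is uncountable while its proper initial segments are all
   countable. ([well_order R] is about the reflexive order.) *)
Definition has_size_aleph1 (T : eqType) : Prop :=
  ~ countable [set: T] /\
  exists R : rel T, well_order R /\
    forall x : T, countable [set y : T | R y x && (y != x)].

Definition is_discrete (T : topologicalType) : Prop :=
  forall A : set T, open A.

(* [Topological S] is the type of topologies on [S]; a topology need not be
   related to any topology that [S] may already carry. *)
Definition T1_topology (S : Type) (tau : Topological S) : Prop :=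
  accessible_space (Topological.Pack tau).

Definition semigroup_topology (S : semigroupType) (tau : Topological S) : Prop :=
  let T : topologicalType := Topological.Pack tau in
  continuous (fun p : T * T => ((p.1 : S) * (p.2 : S) : S) : T).

Definition FM_open (S : semigroupType) : set_system S :=
  [set U : set S | forall tau : Topological S,
     semigroup_topology tau -> T1_topology tau ->
     @open (Topological.Pack tau) U].

Section FMTopology.
Variable S : semigroupType.

Lemma FM_openT : @FM_open S setT.
Proof. by move=> tau _ _; exact: openT. Qed.

Lemma FM_openI : setI_closed (@FM_open S).
Proof.
by move=> A B oA oB tau s t; apply: openI; [exact: oA | exact: oB].
Qed.

Lemma FM_open_bigU (I : Type) (f : I -> set S) :
  (forall i, FM_open (f i)) -> FM_open (\bigcup_i f i).
Proof. by move=> of_ tau s t; apply: bigcup_open => i _; exact: of_. Qed.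

End FMTopology.

(* The semigroup Frechet-Markov topology, carried by an alias of [S]. *)
Definition FM_topology (S : semigroupType) : Type := S.

HB.instance Definition _ (S : semigroupType) :=
  Choice.copy (FM_topology S) S.
HB.instance Definition _ (S : semigroupType) :=
  isOpenTopological.Build (FM_topology S)
    (@FM_openT S) (@FM_openI S) (@FM_open_bigU S).

(* [eps i = true] stands for the exponent 1, [eps i = false] for -1; the
   coefficient following the i-th occurrence of x is [a (lift ord0 i)], i.e.
   a_(i+1). *)
Definition group_polynomial_of_degree (G : groupType) (n : nat) (f : G -> G) :
    Prop :=
  exists (a : 'I_n.+1 -> G) (eps : 'I_n -> bool), forall x : G,
    f x = a ord0 *
          \prod_(i < n) ((if eps i then x else x^-1) * a (lift ord0 i)).

Definition group_polynomial (G : groupType) (f : G -> G) : Prop :=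
  exists n : nat, group_polynomial_of_degree n f.

Definition zariski_subbase (G : groupType) : set (set G) :=
  [set [set x : G | f x <> 1] | f in @group_polynomial G].

(* The group Zariski topology, carried by an alias of [G]. *)
Definition zariski_topology (G : groupType) : Type := G.

HB.instance Definition _ (G : groupType) :=
  Choice.copy (zariski_topology G) G.
HB.instance Definition _ (G : groupType) :=
  isSubBaseTopological.Build (zariski_topology G) (@zariski_subbase G) id.

(* Main.v *)
(* Let H be the free abelian group on omega_1 and X = F_2[H]. A function
   psi : H -> F_2 gives the bilinear form beta(x_g, x_h) = psi(h - g) on X, hence
   a central extension E of X by F_2 with commutators [x, y] = beta(x, y) +
   beta(y, x); H acts on E by translations, and an involution inverting H acts as
   well. The group is G = E : (H : 2).

   Suppose that psi is such that every uncountable A in X contains x, y with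
   [x, c.y] = 1, for a fixed translation c. In a T1 semigroup topology on G some
   neighbourhood V of 1 misses the central involution, and then commutators
   vanish on V n c^-1Vc n E (on E, inverses are positive powers), so this set is
   countable. A translation by h moves the countable support of its elements off
   itself, so E is discrete. The involution turns w into something congruent to
   w^-1 mod E, which makes G discrete. Polynomials restricted to X are quadratic,
   and finitely many quadratic functions on an infinite F_2-space have a common
   nontrivial zero, so the Zariski topology is not discrete.

   To find psi without CH, use Todorcevic's square bracket operation
   [i, j] = min {x > i : e_j(x) <= Delta(r_i, r_j)}, for distinct reals r_i and
   injections e_j of the initial segments into nat: on an uncountable set it takes
   all values in a club. It is computed from an element s = h - g of H, with j the
   top index of s and i the index whose real is nearest to r_j; the value picks,
   through a partition of omega_1 into stationary sets, a pattern that s is tested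
   against. Given an uncountable family in X, one takes b in it and two members
   a, a' far below b that look like b up to a high level, but for which the bracket
   lands on ordinals with different labels; then [a, c.b] and [a', c.b] differ.
   The translation c and the order on H ensure that the chosen pattern is met
   exactly once. *)
From HB Require Import structures.
Require Import Defs.
From mathcomp Require Import all_boot all_order all_algebra.
From mathcomp Require Import all_classical topology wochoice.
From mathcomp Require Import finmap monalg zify ring.

Set Implicit Arguments.
Unset Strict Implicit.
Unset Printing Implicit Defensive.

Import Order.TTheory GRing.Theory.
Local Open Scope classical_set_scope.
Local Open Scope ring_scope.

(** * The group *)

Lemma addFF (a : 'F_2) : a + a = 0.
Proof. exact: (@addrr_pchar2 _ (pchar_Fp (p := 2) isT)). Qed.

Lemma F2_cases (a : 'F_2) : a = 0 \/ a = 1.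
Proof.
case: a => -[|[|//]] i; [left|right]; exact: val_inj.
Qed.

(* [psi] does not occur in the fields: it selects the multiplication. *)
Record skew (H : zmodType) (psi : H -> 'F_2) :=
  Skew { sx : {malg 'F_2[H]}; sz : 'F_2; sh : H; se : bool }.

Section SkewGroup.
Variables (H : zmodType) (psi : H -> 'F_2).
Implicit Types (g h k : H) (e : bool).

Local Notation X := {malg 'F_2[H]}.
Local Notation skew := (skew psi).
Implicit Types x y t : X.

Lemma addXX x : x + x = 0.
Proof. by apply/malgP => k; rewrite mcoeffD addFF mcoeff0. Qed.

(** Over [F_2] the nonzero coefficients are 1, so every element is a sum of basis vectors. *)
Lemma malgF2_ind (P : X -> Prop) :
  P 0 -> (forall x y, P x -> P y -> P (x + y)) -> (forall g, P << g >>) ->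
  forall x, P x.
Proof.
move=> P0 PD PU x; rewrite (monalgE x).
apply: (big_ind P) => // g _.
by case: (F2_cases x@_g) => ->; [rewrite monalgU0|].
Qed.

Definition sg e g : H := if e then - g else g.

Lemma sgK e : involutive (sg e).
Proof. by case: e => g //=; rewrite opprK. Qed.

Lemma sgD e g h : sg e (g + h) = sg e g + sg e h.
Proof. by case: e => //=; rewrite opprD. Qed.

Lemma sgN e g : sg e (- g) = - sg e g.
Proof. by case: e. Qed.

Lemma sg0 e : sg e 0 = 0.
Proof. by case: e => //=; rewrite oppr0. Qed.

Lemma sg_addb e e' g : sg (e (+) e') g = sg e (sg e' g).
Proof. by case: e e' => -[] //=; rewrite opprK. Qed.

Definition act h e x : X :=
  [malg g in [fset (h + sg e k)%R | k in msupp x]%fset => x@_(sg e (g - h))].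

Lemma actE h e x g : (act h e x)@_g = x@_(sg e (g - h)).
Proof.
rewrite /act mcoeffE; case: ifPn => // /negP gN.
apply/esym/eqP; rewrite mcoeff_eq0; apply/negP => gx; apply: gN.
by apply/imfsetP; exists (sg e (g - h)) => //=; rewrite sgK addrC subrK.
Qed.

Lemma actD h e : {morph act h e : x y / x + y}.
Proof. by move=> x y; apply/malgP => g; rewrite !(actE, mcoeffD). Qed.

Lemma act0 h e : act h e 0 = 0.
Proof. by apply/malgP => g; rewrite actE !mcoeff0. Qed.

Lemma act_id x : act 0 false x = x.
Proof. by apply/malgP => g; rewrite actE subr0. Qed.

Lemma act_act h e k e' x :
  act h e (act k e' x) = act (h + sg e k) (e (+) e') x.
Proof.
apply/malgP => g; rewrite !actE [e (+) e']addbC sg_addb.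
by congr (x @_ (sg e' _)); rewrite opprD !sgD !sgN sgK addrA.
Qed.

Lemma actU h e g : act h e << g >> = << h + sg e g >>.
Proof.
apply/malgP => k; rewrite actE !mcoeffU.
have -> : (g == sg e (k - h)) = (h + sg e g == k) => //.
apply/eqP/eqP => [->|<-]; first by rewrite sgK addrC subrK.
by rewrite addrC addKr sgK.
Qed.

Definition lin (f : H -> 'F_2) x : 'F_2 := mmap idfun f x.

Lemma linD f x y : lin f (x + y) = lin f x + lin f y.
Proof. by rewrite /lin mmapD. Qed.

Lemma lin0 f : lin f 0 = 0.
Proof. by rewrite /lin mmap0. Qed.

Lemma linU f g : lin f << g >> = f g.
Proof. by rewrite /lin mmapU mul1r. Qed.

Lemma lin_addf f f' x : lin (fun g => f g + f' g) x = lin f x + lin f' x.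
Proof. by rewrite /lin !mmapE -big_split; apply: eq_bigr => g _; rewrite mulrDr. Qed.

Lemma eq_lin f f' x : {in msupp x, f =1 f'} -> lin f x = lin f' x.
Proof.
move=> ff'; rewrite /lin !mmapE; apply: eq_big_seq => g gx.
by rewrite ff'.
Qed.

Definition beta x y : 'F_2 := lin (fun g => lin (fun h => psi (h - g)) y) x.

Lemma betaDl x y t : beta (x + y) t = beta x t + beta y t.
Proof. exact: linD. Qed.

Lemma betaDr x y t : beta t (x + y) = beta t x + beta t y.
Proof. by rewrite /beta -lin_addf; apply: eq_lin => g _; rewrite linD. Qed.

Lemma beta0l y : beta 0 y = 0. Proof. exact: lin0. Qed.

Lemma beta0r y : beta y 0 = 0.
Proof. by apply: (addIr (beta y 0)); rewrite -betaDr !add0r. Qed.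

Lemma betaUU g h : beta << g >> << h >> = psi (h - g).
Proof. by rewrite /beta !linU. Qed.

(** Translations cancel in the difference [h - g]; inversion negates it, which exchanges the
    arguments of [beta]. *)
Lemma beta_act h e x y :
  beta (act h e x) (act h e y) = if e then beta y x else beta x y.
Proof.
elim/malgF2_ind: x y => [y|x x' IHx IHx' y|g y].
- by rewrite act0 !beta0l !beta0r if_same.
- by rewrite actD betaDl IHx IHx'; case: e {IHx IHx'}; rewrite ?betaDl ?betaDr.
elim/malgF2_ind: y => [|y y' IHy IHy'|k].
- by rewrite act0 !beta0l !beta0r if_same.
- by rewrite actD betaDr IHy IHy'; case: e {IHy IHy'}; rewrite ?betaDl ?betaDr.
rewrite !actU !betaUU opprD addrACA subrr add0r.
by case: e => //=; rewrite opprK addrC.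
Qed.

Definition comm x y : 'F_2 := beta x y + beta y x.

Definition skew_tuple (a : skew) := (sx a, sz a, sh a, se a).
Definition tuple_skew (t : X * 'F_2 * H * bool) :=
  let: (x, z, h, e) := t in Skew psi x z h e.
Lemma skew_tupleK : cancel skew_tuple tuple_skew.
Proof. by case. Qed.

HB.instance Definition _ := Choice.copy skew (can_type skew_tupleK).

(* The inversion of [H] transposes [beta], so it extends to [E] only after
   composition with [u |-> u^-1], which adds [beta x x] to the central part. *)
Definition twist e x : 'F_2 := if e then beta x x else 0.

Lemma twist_act h e e' x : twist e (act h e' x) = twist e x.
Proof. by rewrite /twist beta_act if_same. Qed.

Lemma twist_addb e e' x : twist (e (+) e') x = twist e x + twist e' x.
Proof. by case: e e' => -[]; rewrite /= ?addFF ?addr0 ?add0r. Qed.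

Lemma twistD e x y :
  twist e (x + y) = twist e x + twist e y + (if e then comm x y else 0).
Proof.
case: e => /=; last by rewrite !addr0.
by rewrite /comm betaDl !betaDr; ring.
Qed.

Definition skew_mul (a b : skew) : skew :=
  let y := act (sh a) (se a) (sx b) in
  Skew psi (sx a + y) (sz a + sz b + twist (se a) (sx b) + beta (sx a) y)
       (sh a + sg (se a) (sh b)) (se a (+) se b).

Definition skew_one : skew := Skew psi 0 0 0 false.

Definition skew_inv (a : skew) : skew :=
  let h := - sg (se a) (sh a) in
  let y := act h (se a) (sx a) in
  Skew psi y (sz a + twist (se a) (sx a) + beta (sx a) (sx a)) h (se a).

Lemma skew_eq (a b : skew) :
  sx a = sx b -> sz a = sz b -> sh a = sh b -> se a = se b -> a = b.
Proof. by case: a b => ? ? ? ? [? ? ? ?] /= -> -> -> ->. Qed.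

Lemma skew_mulA : associative skew_mul.
Proof.
case=> [x z h e] [y w k f] [t v l i]; apply: skew_eq; rewrite /skew_mul /=.
- by rewrite actD act_act addrA.
- rewrite actD act_act twistD twist_act twist_addb betaDr betaDl.
  have -> : beta (act h e y) (act (h + sg e k) (e (+) f) t)
      = if e then beta (act k f t) y else beta y (act k f t).
    by rewrite -act_act beta_act.
  rewrite /comm; case: e => /=; last by ring.
  (* When [a] inverts [H], the two sides differ by two copies of this term, which cancel in
     characteristic 2. *)
  by rewrite -[RHS]addr0 -(addFF (beta y (act k f t))); ring.
- by rewrite sgD addrA sg_addb.
- exact: addbA.
Qed.

Lemma skew_mul1 : left_id skew_one skew_mul.
Proof.
case=> [x z h e]; apply: skew_eq => //=.
- by rewrite act_id add0r.
- by rewrite beta0l addr0 addr0 add0r.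
- by rewrite add0r.
Qed.

Lemma skew_mulr1 : right_id skew_one skew_mul.
Proof.
case=> [x z h e]; apply: skew_eq; rewrite /= ?addbF //.
- by rewrite act0 addr0.
- by rewrite act0 beta0r !addr0 /twist beta0r if_same addr0.
- by rewrite sg0 addr0.
Qed.

Lemma skew_mulV : left_inverse skew_one skew_inv skew_mul.
Proof.
case=> [x z h e]; apply: skew_eq; rewrite /= ?addbb //.
- by rewrite -actD addXX act0.
- rewrite beta_act if_same.
  have -> : z + twist e x + beta x x + z + twist e x + beta x x
    = (z + z) + (twist e x + twist e x) + (beta x x + beta x x) by ring.
  by rewrite !addFF ?addr0.
- by rewrite addNr.
Qed.

Lemma skew_mulrV : right_inverse skew_one skew_inv skew_mul.
Proof.
case=> [x z h e]; apply: skew_eq; rewrite /= ?addbb //.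
- by rewrite act_act sgN sgK subrr addbb act_id addXX.
- rewrite act_act sgN sgK subrr addbb act_id twist_act.
  have -> : z + (z + twist e x + beta x x) + twist e x + beta x x
    = (z + z) + (twist e x + twist e x) + (beta x x + beta x x) by ring.
  by rewrite !addFF ?addr0.
- by rewrite sgN sgK subrr.
Qed.

HB.instance Definition _ :=
  isGroup.Build skew skew_mulA skew_mul1 skew_mulr1 skew_mulV skew_mulrV.

End SkewGroup.

(** * Semigroup topologies *)

Section SemigroupTopology.
Variables (G : groupType) (tau : Topological G).
Hypothesis tau_mul : semigroup_topology tau.
Local Notation T := (Topological.Pack tau).

Lemma mulg_continuous (U : topologicalType) (f g : U -> T) :
  continuous f -> continuous g ->
  continuous (fun x => ((f x : G) * (g x : G))%g : T).
Proof.
move=> cf cg x.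
apply: (@continuous_comp _ _ _ (fun x => (f x, g x))
  (fun p : T * T => ((p.1 : G) * (p.2 : G))%g : T)).
  by apply: cvg_pair; [exact: cf|exact: cg].
exact: tau_mul.
Qed.

(** Left translation by a fixed [a^-1] is continuous although inversion need not be. *)
Lemma open1_discrete : @open T [set (1%g : G)] -> forall A : set G, @open T A.
Proof.
move=> o1 A.
have -> : A = \bigcup_(a in A) ((fun x : T => (a^-1 * (x : G))%g : T) @^-1` [set 1%g]).
  apply/seteqP; split=> [x Ax|x [a Aa /= ax]]; first by exists x => //=; rewrite mulVg.
  by rewrite (_ : x = a) // -(mulVKg a x) ax mulg1.
apply: bigcup_open => a _; apply: open_comp => // x _.
by apply: mulg_continuous => y; [exact: cst_continuous|].
Qed.

End SemigroupTopology.

Lemma malgU_inj (K : choiceType) (R : nzRingType) (g h : K) :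
  << g >> = << h >> :> {malg R[K]} -> g = h.
Proof.
move=> /(congr1 (fun x : {malg R[K]} => x@_h)); rewrite !mcoeffU eqxx.
by case: eqP => // _ /esym/eqP; rewrite oner_eq0.
Qed.

(** * Discreteness of the semigroup Frechet-Markov topology *)

Section SkewTopology.
Variables (H : zmodType) (psi : H -> 'F_2).
Local Notation X := {malg 'F_2[H]}.
Local Notation skew := (skew psi).
Local Notation Sk := (Skew psi).
Implicit Types (u v : skew) (x y : X) (g h : H).

Definition in_ext u := sh u = 0 /\ se u = false.

Lemma skew_mulE u v : (u * v)%g = skew_mul u v. Proof. by []. Qed.

Lemma EmulE x z y w :
  (Sk x z 0 false * Sk y w 0 false)%g = Sk (x + y) (z + w + beta psi x y) 0 false.
Proof. by rewrite skew_mulE /skew_mul /= act_id !addr0. Qed.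

Lemma E_eta u : in_ext u -> u = Sk (sx u) (sz u) 0 false.
Proof. by case: u => x z h e [/= -> ->]. Qed.

(* A positive word that is the commutator on [E], which has exponent 4. *)
Definition comm_word u v : skew := (u * v * (u * u * u) * (v * v * v))%g.

Lemma comm_wordE u v : in_ext u -> in_ext v ->
  comm_word u v = Sk 0 (comm psi (sx u) (sx v)) 0 false.
Proof.
move=> /E_eta-> /E_eta->; rewrite /comm_word !EmulE /=; apply: skew_eq => //=.
  by rewrite !addXX !add0r [_ + sx u]addrAC addXX add0r addXX.
rewrite !addXX ?add0r !(betaDl, betaDr) ?(beta0l, beta0r) ?add0r ?addr0 /comm.
set xy := beta psi (sx u) (sx v); set yx := beta psi (sx v) (sx u).
set xx := beta psi (sx u) (sx u); set yy := beta psi (sx v) (sx v).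
pose s := sz u + sz u + (sz v + sz v) + xx + xy + yy.
by transitivity (xy + yx + (s + s)); [rewrite /s; ring|rewrite addFF addr0].
Qed.

Definition tr h : skew := Sk 0 0 h false.
Definition emb x : skew := Sk x 0 0 false.
Definition zeta : skew := Sk 0 1 0 false.
Definition iota1 : skew := Sk 0 0 0 true.

(** Conjugation by a constant is continuous, so neighbourhoods of 1 can be translated along [H]. *)
Lemma tr_conj h x z :
  (tr h * Sk x z 0 false * (tr h)^-1)%g = Sk (act h false x) z 0 false.
Proof.
apply: (canLR (mulgK _)); rewrite !skew_mulE; apply: skew_eq => //=.
- by rewrite add0r act_id addr0.
- by rewrite beta0l act_id beta0r !addr0 add0r.
- by rewrite addr0 add0r.
Qed.

Lemma shM u v : sh (u * v)%g = sh u + sg (se u) (sh v). Proof. by []. Qed.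
Lemma seM u v : se (u * v)%g = se u (+) se v. Proof. by []. Qed.
Lemma shV u : sh (u^-1)%g = - sg (se u) (sh u). Proof. by []. Qed.
Lemma seV u : se (u^-1)%g = se u. Proof. by []. Qed.

(** Compare first components: after cancelling [sx w], two basis vectors are equal. *)
Lemma commute_emb_delta (w : skew) g : (w * emb << g >>)%g = (emb << g >> * w)%g ->
  sh w + sg (se w) g = g.
Proof.
move=> /(congr1 (fun u : skew => sx u)); rewrite /= act_id addrC actU => /addIr.
exact: malgU_inj.
Qed.

Variable c : H.
Hypothesis c2 : c + c != 0.
Hypothesis H_uncountable : ~ countable [set: H].
Hypothesis psiP : forall A : set X, ~ countable A ->
  exists x y, [/\ A x, A y & comm psi x (act c false y) = 1].

Lemma skew_discrete (tau : Topological skew) :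
  semigroup_topology tau -> T1_topology tau ->
  forall A : set skew, @open (Topological.Pack tau) A.
Proof.
move=> tau_mul tau_T1; apply: (open1_discrete tau_mul).
set T := Topological.Pack tau.
have cont_mul := @mulg_continuous _ _ tau_mul.
pose N : set_system skew := @nbhs _ T (1%g : skew).
have NI : forall A B, N A -> N B -> N (A `&` B) by move=> A B; exact: filterI.
have Npre (p : T -> T) : continuous p -> p 1%g = 1%g ->
    forall A, N A -> N (p @^-1` A).
  by move=> cp p1 A NA; apply: (cp (1%g : skew)); rewrite p1.
have ccst (a : skew) : continuous (fun _ : T => a : T) by move=> ?; exact: cvg_cst.
have cid : continuous (fun x : T => x) by move=> ?; exact: cvg_id.
have Nconj a A : N A -> N [set u | A (a * u * a^-1)%g].
  move=> NA; have cp : continuous (fun x : T => (a * (x : skew) * a^-1)%g : T).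
    by apply: (cont_mul) => //; exact: (cont_mul).
  by apply: (Npre _ cp _ A NA); rewrite mulg1 mulgV.
have Nz : N [set u | u <> zeta].
  have /tau_T1 [U [oU [/set_mem U1 /set_mem Uz]]] : (1%g : T) != (zeta : T).
    by apply/eqP => /(congr1 (fun u : skew => sz u)).
  rewrite /N nbhsE /=; exists U => // u Uu uz; apply: Uz; by rewrite -uz.
(* The commutator word is continuous and sends [(1, 1)] to 1. On the extension its only values are 1
   and [zeta], so near 1 it is 1. *)
have [V NV VP] : exists2 V, N V & forall u v, V u -> V v -> in_ext u -> in_ext v ->
    comm psi (sx u) (sx v) = 0.
  pose f (p : T * T) : T := comm_word p.1 p.2.
  have cf : continuous f.
    have c1 : continuous (fun p : T * T => p.1) by move=> ?; exact: cvg_fst.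
    have c2' : continuous (fun p : T * T => p.2) by move=> ?; exact: cvg_snd.
    rewrite /f /comm_word.
    by do 2?[apply: (cont_mul); [|do 2?[apply: (cont_mul) => //]]];
       apply: (cont_mul).
  have f1 : f ((1%g : skew), (1%g : skew)) = 1%g by rewrite /f /comm_word !mulg1.
  have : nbhs (((1%g : skew) : T), ((1%g : skew) : T)) (f @^-1` [set u | u <> zeta]).
    by apply: cf; rewrite f1.
  case=> -[P Q] [/= NP NQ PQ]; exists (P `&` Q); first exact: NI.
  move=> u v [Pu _] [_ Qv] Eu Ev.
  have := PQ (u, v) (conj Pu Qv); rewrite /f /= comm_wordE //.
  by case: (F2_cases (comm psi (sx u) (sx v))) => [->//|-> /(_ erefl)].
pose V' := V `&` [set u | V (tr c * u * (tr c)^-1)%g].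
have NV' : N V' by apply: (NI) => //; exact: Nconj.
pose A := [set x | exists2 z, V' (Sk x z 0 false) & True].
(* Otherwise [psiP] would give two elements of [V] in the extension whose commutator is [zeta]. *)
have Acount : countable A.
  apply: contrapT => /psiP [x [y [[z [Vx _] _] [t [_ /= Vy] _]]]].
  rewrite tr_conj in Vy.
  by have := VP _ _ Vx Vy; rewrite /= => -> //.
pose S : set H := \bigcup_(x in A) [set` msupp x].
have Scount : countable S.
  by apply: bigcup_countable => // x _; exact/finite_set_countable/finite_finset.
pose D := [set p.1 - p.2 | p in S `*` S].
(* As [h] is not a difference of two points of [S], translation by [h] moves every support inside
   [S] off [S]. *)
have [h Dh] : exists h, ~ D h.
  apply: contrapT => nD; apply: H_uncountable.
  apply: (@sub_countable _ _ _ D); last first.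
    by apply: (card_le_trans (card_image_le _ _)); exact: countableX.
  by apply: subset_card_le => g _; apply: contrapT => Dg; apply: nD; exists g.
pose W := [set u | u <> zeta] `&` (V' `&` [set u | V' (tr h * u * (tr h)^-1)%g]).
have NW : N W by apply: (NI) => //; apply: (NI) => //; exact: Nconj.
have WE u : W u -> in_ext u -> u = 1%g.
  move=> [uz [Vu /= Vhu]] Eu; move: (Eu) uz Vu Vhu => /E_eta ->.
  rewrite tr_conj; set x := sx u => uz Vu Vhu.
  suff x0 : x = 0.
    move: uz; rewrite x0.
    by case: (F2_cases (sz u)) => -> // /(_ erefl).
  apply/malgP => g; rewrite mcoeff0; apply/eqP; rewrite mcoeff_eq0; apply/negP => gx.
  apply: Dh; exists (h + g, g); last by rewrite /= addrK.
  split=> /=; last by exists x => //; exists (sz u).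
  exists (act h false x); first by exists (sz u).
  by rewrite /= -mcoeff_neq0 actE /= [h + g]addrC addrK mcoeff_neq0.
have Nword (p : T -> T) : continuous p -> p 1%g = 1%g ->
    N [set w | in_ext (p w) -> p w = 1%g].
  move=> cp p1; apply: filterS (Npre p cp p1 W NW) => w Ww Ew.
  exact: WE.
(* For suitable constants [a] this product falls into the extension even if [w] does not, and there
   it must be 1 for [w] near 1. *)
pose q1 (a w : skew) : skew := (w * (a * w * a^-1))%g.
have Nq a : N [set w | in_ext (q1 a w) -> q1 a w = 1%g].
  apply: (Nword); last by rewrite /q1 mulg1 mul1g mulgV.
  by rewrite /q1; do 3?[apply: (cont_mul) => //].
have N1 : N [set 1%g].
  have := NI _ _ (NI _ _ NW (NI _ _ (Nq iota1) (Nq (emb << 0 >> * iota1)%g)))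
    (NI _ _ (Nq 1%g) (NI _ _ (Nq (emb << 0 >>)) (Nq (emb << c >>)))).
  apply: filterS => w [[Ww [w1 w2]] [w3 [w4 w5]]].
  move: w1 w2 w3 w4 w5; rewrite /mkset => w1 w2 w3 w4 w5.
  (* Both [a] and its conjugate by [b] are the inverse of [w], so [b] commutes with [w]. *)
  have comm_of a b : (w * a)%g = 1%g -> (w * (b * a * b^-1))%g = 1%g ->
      (w * b)%g = (b * w)%g.
    move=> wa wb; have aw : a = (w^-1)%g by rewrite (mulg1_eq wa).
    have : (b * w^-1 * b^-1)%g = (w^-1)%g.
      by rewrite -aw -(mulg1_eq wb) aw.
    move=> /(congr1 (fun t : skew => t^-1)%g); rewrite !invgM !invgK.
    move=> /(congr1 (fun t : skew => t * b)%g).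
    by rewrite mulgA mulgVK => <-.
  (* If [w] inverts [H], it commutes with the basis vectors at 0 and at [c]; this gives [sh w = 0]
     and [- c = c], against [c2]. *)
  case E : (se w).
    have {}w3 : (w * w)%g = 1%g.
      have := w3; rewrite /q1 mul1g invg1 mulg1; apply.
      by split; rewrite ?shM ?seM E //= subrr.
    have cw g : in_ext (q1 (emb << g >>) w) -> q1 (emb << g >>) w = 1%g ->
        sh w - g = g.
      move=> Eq q; have := @commute_emb_delta w g (comm_of _ _ w3 q).
      by rewrite E.
    have Eg g : in_ext (q1 (emb << g >>) w).
      rewrite /q1; split; rewrite ?(shM, seM, shV, seV) E //=.
      by rewrite ?(sg0, add0r, oppr0, addr0) subrr.
    have := cw _ (Eg 0) (w4 (Eg 0)); rewrite subr0 => hw.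
    have := cw _ (Eg c) (w5 (Eg c)); rewrite hw sub0r => /eqP.
    by rewrite -subr_eq0 -opprD oppr_eq0 (negPf c2).
  (* Otherwise conjugation by [iota1] negates [sh w], so the products lie in the extension.
     Commuting with the basis vector at 0 then gives [sh w = 0]. *)
  have {}w1 : (w * (iota1 * w * iota1^-1))%g = 1%g.
    apply: w1; split; rewrite /q1 ?(shM, seM, shV, seV) E //=.
    by rewrite !oppr0 add0r addr0 subrr.
  have {}w2 : (w * (emb << 0 >> * (iota1 * w * iota1^-1) * (emb << 0 >>)^-1))%g = 1%g.
    have <- : q1 (emb << 0 >> * iota1)%g w
      = (w * (emb << 0 >> * (iota1 * w * iota1^-1) * (emb << 0 >>)^-1))%g.
      by rewrite /q1 invgM !mulgA.
    apply: w2; split; rewrite /q1 ?(shM, seM, shV, seV) E //=.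
    by rewrite !(oppr0, add0r, addr0) subrr.
  have := @commute_emb_delta w 0 (comm_of _ _ w1 w2); rewrite sg0 addr0 => hw.
  by apply: WE => //; split.
move: N1; rewrite /N => N1.
by rewrite openE => u /= ->; exact: N1.
Qed.

Lemma skew_FM_discrete : is_discrete (FM_topology skew).
Proof.
move=> A; have : @FM_open skew A by move=> tau tm tT; exact: (skew_discrete tm tT).
exact.
Qed.

End SkewTopology.

(** * Polynomials are quadratic on [X] *)

Lemma infinite_fibre (S : Type) (T : finType) (f : S -> T) :
  infinite_set [set: S] -> exists t, infinite_set (f @^-1` [set t]).
Proof.
move=> Sinf; apply: contrapT => noinf; apply: Sinf.
have -> : [set: S] = \bigcup_(t in [set: T]) (f @^-1` [set t]).
  by apply/seteqP; split => // s _; exists (f s).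
apply: bigcup_finite => [|t _]; first exact: finite_finset.
by apply: contrapT => ?; apply: noinf; exists t.
Qed.

Section Quadratic.
Variable X : zmodType.
Hypothesis X2 : forall x : X, x + x = 0.
Implicit Types (q : X -> 'F_2) (x y t : X).

(** Degree at most two, expressed by the polar form [b]. The second equation makes [b] symmetric,
    hence biadditive. *)
Definition quad q := exists2 b : X -> X -> 'F_2,
  forall x y t, b (x + y) t = b x t + b y t &
  forall x y, q (x + y) = q x + q y + q 0 + b x y.

Lemma quadD q q' : quad q -> quad q' -> quad (fun x => q x + q' x).
Proof.
move=> [b bD bq] [b' bD' bq']; exists (fun x y => b x y + b' x y) => *.
  by rewrite bD bD'; ring.
by rewrite bq bq'; ring.
Qed.

Lemma quad_cst (a : 'F_2) : quad (fun=> a).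
Proof. by exists (fun _ _ => 0) => *; rewrite ?addr0 // addFF add0r. Qed.

Lemma quad_additive (L : X -> 'F_2) : {morph L : x y / x + y} -> quad L.
Proof.
move=> LD; have L0 : L 0 = 0 by apply: (addIr (L 0)); rewrite -LD !add0r.
by exists (fun _ _ => 0) => *; rewrite ?LD ?L0 !addr0.
Qed.

Lemma quad_diag (b : X -> X -> 'F_2) :
  (forall x y t, b (x + y) t = b x t + b y t) ->
  (forall x y t, b t (x + y) = b t x + b t y) -> quad (fun x => b x x).
Proof.
move=> bl br.
have b0 : b 0 0 = 0 by apply: (addIr (b 0 0)); rewrite -bl !add0r.
exists (fun x y => b x y + b y x) => *; rewrite ?bl ?br; first by ring.
by rewrite b0; ring.
Qed.

(** Pigeonhole: among more pairwise orthogonal vectors than there are tuples of values, two have the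
    same values, and their sum is a common zero. *)
Lemma quad_common_zero (I : finType) (q : I -> X -> 'F_2) :
  infinite_set [set: X] ->
  (forall i, quad (q i)) -> (forall i, q i 0 = 0) ->
  exists2 x, x != 0 & forall i, q i x = 0.
Proof.
move=> Xinf quadq q0.
pose val x := [ffun i => q i x].
(* On pairwise orthogonal vectors the [q i] are additive. *)
have [ys ys_size [ys_uniq ys0 ysD]] : exists2 ys : seq X,
    size ys = #|{ffun I -> 'F_2}|.+1 &
    [/\ uniq ys, 0 \notin ys & forall y y', y \in ys -> y' \in ys -> y != y' ->
      forall i, q i (y + y') = q i y + q i y'].
  elim: _.+1 => [|n [ys ys_size [ys_uniq ys0 ysD]]]; first by exists [::].
  have /choice[b bP] : forall i, exists b : X -> X -> 'F_2,
      (forall x y t, b (x + y) t = b x t + b y t) /\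
      forall x y, q i (x + y) = q i x + q i y + b x y.
    by move=> i; have [b ? bq] := quadq i; exists b; split=> // x y; rewrite bq q0 addr0.
  (* Two vectors with the same products against [ys] have a sum orthogonal to [ys]; in an infinite
     fibre the sum can be made to avoid 0 and [ys]. *)
  pose f x := [ffun p : I * seq_sub ys => b p.1 x (ssval p.2)].
  have [v vinf] := infinite_fibre f Xinf.
  have [x0 fx0] := infinite_setN0 vinf.
  have [x fx xN] : exists2 x, f x = v & x + x0 \notin 0 :: ys.
    apply: contrapT => nox; apply: vinf.
    apply: (@sub_finite_set _ _ [set x0 + y | y in [set` 0 :: ys]]).
      move=> x /= fx; exists (x + x0); last by rewrite addrCA X2 addr0.
      by apply: contrapT => /negP ?; apply: nox; exists x.
    by apply: finite_image; exact: finite_seq.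
  have bz y i : y \in ys -> b i (x + x0) y = 0.
    move=> yys; have := congr1 (fun g => fun_of_fin g (i, SeqSub yys)) fx.
    have := congr1 (fun g => fun_of_fin g (i, SeqSub yys)) fx0.
    by rewrite !ffunE /= => e0 e; rewrite (bP i).1 e e0 addFF.
  have Dz y i : y \in ys -> q i (x + x0 + y) = q i (x + x0) + q i y.
    by move=> yys; rewrite (bP i).2 bz // addr0.
  move: xN; rewrite inE negb_or => /andP[xx0 xys].
  exists (x + x0 :: ys); first by rewrite /= ys_size.
  split=> [||y y']; rewrite /= ?xys // !inE ?negb_or ?ys0 ?andbT.
    by rewrite eq_sym.
  case/orP => [/eqP->|yys]; case/orP => [/eqP->|yys'].
  - by rewrite eqxx.
  - by move=> _ i; exact: Dz.
  - by move=> _ i; rewrite addrC Dz // addrC.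
  - exact: ysD.
have [y [y' [yys yys' yy' vv]]] : exists y y',
    [/\ y \in ys, y' \in ys, y != y' & val y = val y'].
  apply: contrapT => noyy.
  have /map_inj_in_uniq : {in ys &, injective val}.
    move=> y y' yys yys' vv; apply/eqP/negPn/negP => ?; apply: noyy.
    by exists y, y'.
  rewrite ys_uniq => /card_uniqP /=.
  rewrite size_map ys_size => e.
  by have := max_card [in map val ys]; rewrite e ltnn.
exists (y + y') => [|i].
  apply: contra yy' => /eqP e; apply/eqP.
  by rewrite -[y]addr0 -(X2 y') addrA e add0r.
have /ffunP/(_ i) := vv; rewrite !ffunE ysD // => ->.
exact: addFF.
Qed.

End Quadratic.

(** * Zariski neighbourhoods of the identity *)

Section Zariski.
Variables (H : zmodType) (psi : H -> 'F_2).
Local Notation X := {malg 'F_2[H]}.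
Local Notation skew := (skew psi).
Implicit Types (x y : X) (g h : H).

(** A shape preserved by products: affine in [X], quadratic in the centre [F_2], constant in the
    quotient by the extension. *)
Definition quadratic_map (f : X -> skew) := exists L : X -> X,
  [/\ {morph L : x y / x + y}, forall x, sx (f x) = sx (f 0) + L x,
     quad (fun x => sz (f x)), forall x, sh (f x) = sh (f 0) &
     forall x, se (f x) = se (f 0)].

Lemma quad_beta (L L' : X -> X) a a' :
  {morph L : x y / x + y} -> {morph L' : x y / x + y} ->
  quad (fun x => beta psi (a + L x) (a' + L' x)).
Proof.
move=> LD LD'.
have -> : (fun x => beta psi (a + L x) (a' + L' x)) = fun x =>
   beta psi a a' + beta psi a (L' x) + beta psi (L x) a' + beta psi (L x) (L' x).
  by apply/funext => x; rewrite betaDl !betaDr; ring.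
apply: quadD; last first.
  by apply: (quad_diag (b := fun x y => beta psi (L x) (L' y))) => *;
    rewrite ?LD ?LD' ?betaDl ?betaDr.
apply: quadD; last by apply: quad_additive => x y; rewrite /= LD betaDl.
apply: quadD; first exact: quad_cst.
by apply: quad_additive => x y; rewrite /= LD' betaDr.
Qed.

Lemma quadratic_map_cst (u : skew) : quadratic_map (fun=> u).
Proof.
exists (fun=> 0); split=> [x y|x||x|x]; rewrite ?addr0 //.
exact: quad_cst.
Qed.

Lemma quadratic_mapM (f f' : X -> skew) :
  quadratic_map f -> quadratic_map f' -> quadratic_map (fun x => f x * f' x)%g.
Proof.
move=> [L [LD Lf qf hf ef]] [L' [LD' Lf' qf' hf' ef']].
pose M x := act (sh (f 0)) (se (f 0)) (L' x).
have MD : {morph M : x y / x + y} by move=> x y; rewrite /M LD' actD.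
have Mf x : act (sh (f x)) (se (f x)) (sx (f' x))
    = act (sh (f 0)) (se (f 0)) (sx (f' 0)) + M x by rewrite hf ef Lf' actD.
have M0 : M 0 = 0 by apply: (addIr (M 0)); rewrite -MD !add0r.
exists (fun x => L x + M x); split=> [x y|x||x|x].
- by rewrite LD MD addrACA.
- by rewrite /= Mf Lf addrACA.
- have -> : (fun x => sz (f x * f' x)%g) = fun x => sz (f x) + sz (f' x)
    + twist psi (se (f 0)) (sx (f' 0) + L' x)
    + beta psi (sx (f 0) + L x) (act (sh (f 0)) (se (f 0)) (sx (f' 0)) + M x).
    by apply/funext => x; rewrite /= Mf Lf ef Lf'.
  apply: quadD; last exact: quad_beta.
  apply: quadD; first exact: quadD.
  rewrite /twist; case: (se _); last exact: quad_cst.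
  exact: quad_beta.
- by rewrite !shM hf ef hf'.
- by rewrite !seM ef ef'.
Qed.

Lemma quadratic_map_emb : quadratic_map (fun x => emb psi x).
Proof.
exists id; split=> [x y|x||x|x]; rewrite /= ?add0r //.
exact: quad_cst.
Qed.

Lemma emb_inv x : (emb psi x)^-1%g = Skew psi x (beta psi x x) 0 false.
Proof. by apply: skew_eq; rewrite /= ?oppr0 ?act_id ?add0r. Qed.

Lemma quadratic_map_embV : quadratic_map (fun x => (emb psi x)^-1)%g.
Proof.
have -> : (fun x => (emb psi x)^-1)%g = fun x => Skew psi x (beta psi x x) 0 false.
  by apply/funext => x; rewrite emb_inv.
exists id; split=> [x y|x||x|x]; rewrite /= ?add0r //.
by apply: (quad_diag (b := beta psi)) => *; rewrite ?betaDl ?betaDr.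
Qed.

Lemma quadratic_map_poly (f : skew -> skew) :
  group_polynomial f -> quadratic_map (fun x => f (emb psi x)).
Proof.
move=> [n [a [eps fE]]].
have -> : (fun x => f (emb psi x)) = fun x => (a ord0 *
   \prod_(i < n) ((if eps i then emb psi x else (emb psi x)^-1) * a (lift ord0 i)))%g.
  by apply/funext => x; rewrite fE.
apply: quadratic_mapM; first exact: quadratic_map_cst.
move: (index_enum _) => s; elim: s => [|i s IHs].
  have -> : (fun x : X => \prod_(i <- [::])
     ((if eps i then emb psi x else (emb psi x)^-1) * a (lift ord0 i)))%g = fun=> 1%g.
    by apply/funext => x; rewrite big_nil.
  exact: quadratic_map_cst.
have -> : (fun x : X => \prod_(j <- i :: s)
     ((if eps j then emb psi x else (emb psi x)^-1) * a (lift ord0 j)))%g =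
   (fun x : X => ((if eps i then emb psi x else (emb psi x)^-1) * a (lift ord0 i))
     * \prod_(j <- s)
     ((if eps j then emb psi x else (emb psi x)^-1) * a (lift ord0 j)))%g.
  by apply/funext => x; rewrite big_cons.
apply: quadratic_mapM => //; apply: quadratic_mapM; last exact: quadratic_map_cst.
by case: (eps i); [exact: quadratic_map_emb|exact: quadratic_map_embV].
Qed.

(** Since [f 1 <> 1], some component of [f 1] is nontrivial. A quotient component is constant along
    [X]; a coefficient in [X], or the central component, is kept nontrivial by the vanishing of an
    additive or quadratic function. *)
Lemma zariski_subbase_quad (U : set skew) : zariski_subbase U -> U 1%g ->
  exists q : X -> 'F_2, [/\ quad q, q 0 = 0 & forall x, q x = 0 -> U (emb psi x)].
Proof.
move=> [f /quadratic_map_poly [L [LD Lf qf hf ef]] <-] /= f1.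
have L0 : L 0 = 0 by apply: (addIr (L 0)); rewrite -LD !add0r.
have e0 : emb psi 0 = 1%g by [].
have [h0|hN] := eqVneq (sh (f 1%g)) 0; last first.
  exists (fun=> 0); split=> // [|x _ fx]; first exact: quad_cst.
  by move: hN; rewrite -e0 -(hf x) fx eqxx.
case ee : (se (f 1%g)).
  exists (fun=> 0); split=> // [|x _ fx]; first exact: quad_cst.
  by move: ee; rewrite -e0 -(ef x) fx.
have [x0|] := eqVneq (sx (f 1%g)) 0; last first.
  case: (fset_0Vmem (msupp (sx (f 1%g)))) => [m0 /eqP[]|[g gf] _].
    by apply/malgP => k; rewrite mcoeff0 mcoeff_outdom // m0 inE.
  exists (fun x => (L x)@_g); split=> [||x qx fx].
  - by apply: quad_additive => x y; rewrite LD mcoeffD.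
  - by rewrite L0 mcoeff0.
  have := congr1 (fun u : skew => (sx u)@_g) fx.
  rewrite /= Lf mcoeffD qx addr0 mcoeff0 e0 => /eqP.
  by rewrite mcoeff_eq0 gf.
have z1 : sz (f 1%g) = 1.
  case: (F2_cases (sz (f 1%g))) => // z0; case: f1; exact: skew_eq.
exists (fun x => sz (f (emb psi x)) + 1); split=> [||x /eqP qx fx].
- by apply: quadD => //; exact: quad_cst.
- by rewrite e0 z1 addFF.
by move: qx; rewrite fx /= add0r oner_eq0.
Qed.

Lemma skew_zariski_not_discrete : infinite_set [set: X] ->
  ~ is_discrete (zariski_topology skew).
Proof.
move=> Xinf /(_ [set 1%g]) [D' D'sub D'E].
have [B D'B B1] : (\bigcup_(i in D') i) (1%g : skew) by rewrite D'E.
have [F /= Fsub BE] := D'sub _ D'B.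
have F1 (U : set skew) : U \in F -> U 1%g.
  by move=> UF; move: B1; rewrite -BE; apply.
have /choice[q qP] : forall i : F, exists q : X -> 'F_2,
    [/\ quad q, q 0 = 0 & forall x, q x = 0 -> (fsval i) (emb psi x)].
  move=> i; apply: zariski_subbase_quad; last exact: F1 (fsvalP i).
  exact: set_mem (Fsub _ (fsvalP i)).
have [x x0 qx] := quad_common_zero (@addXX H) Xinf (fun i => let: And3 a _ _ := qP i in a)
  (fun i => let: And3 _ b _ := qP i in b).
have : (\bigcup_(i in D') i) (emb psi x).
  exists B => //.
  rewrite -BE => U UF; have [_ _] := qP [` UF]%fset; apply; exact: qx.
rewrite D'E => /(congr1 (fun u : skew => sx u)) /= xx.
by rewrite xx eqxx in x0.
Qed.

End Zariski.

(** * The first uncountable ordinal *)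

Lemma uncountable_fibre (S T : Type) (A : set S) (f : S -> T) (C : set T) :
  ~ countable A -> countable C -> (forall x, A x -> C (f x)) ->
  exists t, ~ countable (A `&` f @^-1` [set t]).
Proof.
move=> Aunc Cc fC; apply: contrapT => allc; apply: Aunc.
apply: (@sub_countable _ _ _ (\bigcup_(t in C) (A `&` f @^-1` [set t]))).
  by apply: subset_card_le => x Ax; exists (f x); [exact: fC|].
apply: bigcup_countable => // t _.
by apply: contrapT => ?; apply: allc; exists t.
Qed.

Lemma countable_sub (S : Type) (A B : set S) :
  A `<=` B -> countable B -> countable A.
Proof. by move=> /subset_card_le; exact: sub_countable. Qed.

Lemma countable_setU (S : Type) (A B : set S) :
  countable A -> countable B -> countable (A `|` B).
Proof.
by move=> Ac Bc; rewrite -bigcup2E; apply: bigcup_countable => // -[|[|n]] _ //=.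
Qed.

Lemma uncountable_setD (S : Type) (A B : set S) :
  ~ countable A -> countable B -> ~ countable (A `\` B).
Proof.
move=> Aunc Bc Dc; apply: Aunc; apply: (countable_sub _ (countable_setU Dc Bc)).
by move=> x Ax; have [?|?] := pselect (B x); [right|left].
Qed.

Lemma uncountable_nonempty (S : Type) (A : set S) :
  ~ countable A -> exists x, A x.
Proof.
move=> Aunc; apply: contrapT => noA; apply: Aunc.
by apply: (countable_sub _ (countable0 S)) => x Ax; case: noA; exists x.
Qed.

Section Omega1.
Variables (disp : Order.disp_t) (I : orderType disp).
Hypothesis I_wf : forall A : set I, A !=set0 ->
  exists2 m, A m & forall i, A i -> (m <= i)%O.
Hypothesis I_seg : forall i : I, countable [set j : I | (j < i)%O].
Hypothesis I_unc : ~ countable [set: I].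
Implicit Types (i j : I) (A : set I).

Lemma countable_le j : countable [set i | (i <= j)%O].
Proof.
apply: (countable_sub _ (countable_setU (I_seg j) (countable1 j))) => i /=.
by rewrite le_eqVlt => /orP[/eqP|]; [right|left].
Qed.

Lemma countable_bounded A : countable A -> exists i, forall j, A j -> (j < i)%O.
Proof.
move=> Ac; apply: contrapT => nob; apply: I_unc.
apply: (@countable_sub _ _ (\bigcup_(j in A) [set i | (i <= j)%O])); last first.
  by apply: bigcup_countable => // j _; exact: countable_le.
move=> i _; apply: contrapT => noj; apply: nob; exists i => j Aj.
by rewrite ltNge; apply/negP => ij; apply: noj; exists j.
Qed.

(** Take the least strict upper bound of a sequence in which each term bounds the values of [F] up
    to the previous term. *)
Lemma closed_point (F : I -> I) i0 :
  exists2 d, (i0 < d)%O & forall i, (i < d)%O -> (F i < d)%O.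
Proof.
have /choice[G GP] : forall k, exists k', (k < k')%O /\
    forall i, (i <= k)%O -> (F i < k')%O.
  move=> k; have [k' k'P] := countable_bounded
    (countable_setU (countable1 k) (card_le_trans (card_image_le F _) (countable_le k))).
  exists k'; split; first by apply: k'P; left.
  by move=> i ik; apply: k'P; right; exists i.
pose x n := iter n G i0.
have [d dx dmin] := I_wf (countable_bounded (card_le_trans (card_image_le x [set: nat])
  (countableP _))).
exists d; first by apply: dx; exists 0%N.
move=> i id; have [n xn] : exists n, (i <= x n)%O.
  apply: contrapT => non; have : (d <= i)%O; last by rewrite leNgt id.
  by apply: dmin => _ [n _ <-]; rewrite ltNge; apply/negP => ?; apply: non; exists n.
by apply: lt_trans ((GP _).2 _ xn) _; apply: dx; exists n.+1.
Qed.

Lemma uncountable_unbounded A : ~ countable A ->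
  forall i, exists2 j, A j & (i < j)%O.
Proof.
move=> Aunc i; apply: contrapT => noj; apply: Aunc.
apply: (countable_sub _ (countable_le i)) => j Aj /=.
by rewrite leNgt; apply/negP => ij; apply: noj; exists j.
Qed.

(** The ordinals above [i0] closed under [F] form a club, and every club contains a club of this
    form, so this is the usual notion. *)
Definition stationary A := forall (F : I -> I) i0,
  exists d, [/\ A d, (i0 < d)%O & forall i, (i < d)%O -> (F i < d)%O].

Lemma seg_injections : exists e : I -> I -> nat, forall j i i',
  (i <= j)%O -> (i' <= j)%O -> e j i = e j i' -> i = i'.
Proof.
have /choice[e eP] : forall j, exists f : I -> nat,
    {in [set i | (i <= j)%O] &, injective f}.
  by move=> j; exact/countable_injP/countable_le.
by exists e => j i i' ij i'j; apply: eP; exact: mem_set.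
Qed.

Variable e : I -> I -> nat.
Hypothesis e_inj : forall j i i',
  (i <= j)%O -> (i' <= j)%O -> e j i = e j i' -> i = i'.

Lemma finite_e j n : finite_set [set i | (i <= j)%O /\ (e j i <= n)%N].
Proof.
set D := [set i | _].
have Dinj : {in D &, injective (e j)}.
  by move=> i i' /set_mem[ij _] /set_mem[i'j _]; exact: e_inj.
rewrite -(eq_finite_set (inj_card_eq Dinj)).
by apply: (sub_finite_set _ (finite_II n.+1)) => _ [i [_ /=]] + <-.
Qed.

(* Ulam: [S n i] and [S n i'] are disjoint by injectivity of the [e j], and for
   some [n] uncountably many of the [S n i] are stationary. *)
Lemma stationary_partition (L : countType) (l0 : L) :
  exists l : I -> L, forall a, stationary [set i | l i = a].
Proof.
pose S n i := [set j | (i < j)%O /\ e j i = n].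
have [n nunc] : exists n, ~ countable [set i | stationary (S n i)].
  apply: contrapT => alln.
  have /uncountable_nonempty[i /= iN] : ~ countable
      (setT `\` \bigcup_n [set i | stationary (S n i)]).
    apply: uncountable_setD => //; apply: bigcup_countable => // n _.
    by apply: contrapT => ?; apply: alln; exists n.
  (* If no [S n i] is stationary, some [d > i] is closed under all the witnessing functions at once;
     yet [d] is in [S n i] for [n = e d i]. *)
  have /choice[F FP] : forall n, exists F : (I -> I) * I, forall d,
      S n i d -> (F.2 < d)%O -> exists2 i', (i' < d)%O & (d <= F.1 i')%O.
    move=> n; apply: contrapT => noF; apply: iN.2; exists n => // F i0.
    apply: contrapT => nod; apply: noF; exists (F, i0) => d Sd i0d.
    apply: contrapT => noi'; apply: nod; exists d; split=> // i' i'd.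
    by rewrite ltNge; apply/negP => ?; apply: noi'; exists i'.
  have bnd (x : nat -> I) : exists j, forall n, (x n < j)%O.
    have [j jP] := countable_bounded
      (card_le_trans (card_image_le x [set: nat]) (countableP _)).
    by exists j => m; apply: jP; exists m.
  have /choice[G GP] : forall i', exists j, forall n, ((F n).1 i' < j)%O.
    by move=> i'; exact: bnd.
  have [i0 i0P] := bnd (fun n => (F n).2).
  have [d i0d dG] := closed_point G (Order.max i i0).
  move: i0d; rewrite gt_max => /andP[id i0d].
  have [i' i'd] := FP (e d i) d (conj id erefl) (lt_trans (i0P _) i0d).
  by rewrite leNgt (lt_trans (GP i' _) (dG _ i'd)).
have /choice[next nextP] : forall i, exists j, stationary (S n j) /\ (i < j)%O.
  by move=> i; have [j] := uncountable_unbounded nunc i; exists j.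
have [j0 j0S] := uncountable_nonempty nunc.
pose g k := iter k next j0.
have gS k : stationary (S n (g k)) by case: k => //= k; exact: (nextP _).1.
have g_inj : injective g.
  have gmono : {homo g : k k' / (k < k')%N >-> (k < k')%O}.
    by apply: homo_ltn => [? ? ?|k]; [exact: lt_trans|exact: (nextP _).2].
  move=> k k' gkk'; case: (ltngtP k k') => // /gmono; by rewrite gkk' ltxx.
have /choice[l lP] : forall j, exists a : L, forall a',
    S n (g (choice.pickle a')) j -> a = a'.
  move=> j; have [[a [ja ea]]|noa] := pselect (exists a : L, S n (g (choice.pickle a)) j).
    exists a => a' [ja' ea']; apply: (pcan_inj choice.pickleK); apply: g_inj.
    by apply: (@e_inj j); rewrite ?ltW // ea ea'.
  by exists l0 => a' ?; case: noa; exists a'.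
exists l => a F i0; have [d [Sd i0d dF]] := gS (choice.pickle a) F i0.
by exists d; split=> //; exact: lP.
Qed.

Lemma finite_bound_below (D : set I) d i0 : finite_set D -> (i0 < d)%O ->
  exists i1, [/\ (i0 <= i1)%O, (i1 < d)%O &
    forall i, D i -> (i < d)%O -> (i <= i1)%O].
Proof.
move=> /finite_seqP[s ->] i0d.
elim: s => [|i s [i1 [i01 i1d i1P]]]; first by exists i0.
have [id|di] := ltP i d; last first.
  exists i1; split=> // i' /=; rewrite inE => /orP[/eqP->|]; last exact: i1P.
  by rewrite ltNge di.
exists (Order.max i i1); rewrite le_max i01 orbT gt_max id i1d; split=> // i' /=.
by rewrite inE le_max => /orP[/eqP->|?]; rewrite ?lexx // => ?; rewrite i1P ?orbT.
Qed.

End Omega1.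

(** * Finitely supported functions *)

Section Restriction.
Variables (K : choiceType) (G : zmodType) (p : pred K).
Implicit Types x y : {malg G[K]}.

Definition restr x : {malg G[K]} := [malg k in msupp x => if p k then x@_k else 0].

Lemma restrE x k : (restr x)@_k = if p k then x@_k else 0.
Proof.
rewrite /restr mcoeffE; case: ifPn => // kx; rewrite mcoeff_outdom ?if_same //.
Qed.

Lemma restrD x y : restr (x + y) = restr x + restr y.
Proof.
by apply/malgP => k; rewrite !(restrE, mcoeffD); case: ifP; rewrite ?addr0.
Qed.

Lemma restrN x : restr (- x) = - restr x.
Proof.
by apply/malgP => k; rewrite !(restrE, mcoeffN); case: ifP; rewrite ?oppr0.
Qed.

Lemma restr_id x : (forall k, k \in msupp x -> p k) -> restr x = x.
Proof.
move=> px; apply/malgP => k; rewrite restrE; case: ifPn => // pk.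
by rewrite mcoeff_outdom //; apply: contra pk; exact: px.
Qed.

Lemma msupp_restr x k : (k \in msupp (restr x)) = (k \in msupp x) && p k.
Proof.
by rewrite -!mcoeff_neq0 restrE; case: ifP => _; rewrite ?andbT ?eqxx ?andbF.
Qed.

End Restriction.

(** An element is determined by its graph over the support, a finite subset of a countable
    product. *)
Lemma countable_malg (K : choiceType) (G : zmodType) (S : set K) :
  countable S -> countable [set: G] ->
  countable [set x : {malg G[K]} | forall k, k \in msupp x -> S k].
Proof.
move=> Sc Gc; set A := [set x | _].
pose graph (x : {malg G[K]}) := [set (k, x@_k) | k in [set` msupp x]].
have graph_inj : {in A &, injective graph}.
  have half x y k : graph x = graph y -> k \in msupp x -> x@_k = y@_k.
    move=> xy kx; have : graph y (k, x@_k) by rewrite -xy; exists k.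
    by case=> l _ [-> ->].
  move=> x y _ _ xy; apply/malgP => k.
  have [kx|kx] := boolP (k \in msupp x); first exact: half.
  have [ky|ky] := boolP (k \in msupp y); first exact/esym/half.
  by rewrite !mcoeff_outdom.
rewrite -(eq_countable (inj_card_eq graph_inj)).
apply: (countable_sub _ (countable_finite_subset (countableX Sc Gc))).
move=> _ [x xA <-]; split; last exact/finite_image/finite_fset.
by move=> _ [k kx <-]; split=> //; exact: xA.
Qed.

Section Push.
Variables (K L : choiceType) (f : K -> L).
Implicit Types x y : {malg int[K]}.

(** The homomorphism induced by [f]: coefficients of indices that [f] identifies are added. *)
Definition push x : {malg int[L]} := \sum_(k <- msupp x) << x@_k *g f k >>.

Lemma pushEw (D : {fset K}) x : (msupp x `<=` D)%fset ->
  push x = \sum_(k <- D) << x@_k *g f k >>.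
Proof.
move=> le; rewrite [LHS](big_fset_incl _ le) //= => k _ /mcoeff_outdom ->.
by rewrite monalgU0.
Qed.

Lemma pushD x y : push (x + y) = push x + push y.
Proof.
pose D := (msupp x `|` msupp y)%fset.
rewrite (pushEw (D := D) (msuppD_le x y)) (pushEw (D := D) (fsubsetUl _ _)).
rewrite (pushEw (D := D) (fsubsetUr _ _)) -big_split /=; apply: eq_bigr => k _.
by rewrite mcoeffD monalgUD.
Qed.

Lemma pushN x : push (- x) = - push x.
Proof.
rewrite (pushEw (D := msupp x)) ?msuppN // /push -sumrN; apply: eq_bigr => k _.
by rewrite mcoeffN monalgUN.
Qed.

Lemma push_coef x l : (push x)@_l = \sum_(k <- msupp x) x@_k *+ (f k == l).
Proof. by rewrite /push raddf_sum /=; apply: eq_bigr => k _; rewrite mcoeffU. Qed.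

Lemma push_supp x l : (push x)@_l != 0 -> exists2 k, k \in msupp x & f k = l.
Proof.
move=> xl; apply: contrapT => nok; case/eqP: xl.
rewrite push_coef big1_seq // => k /= kx; case: eqP => // fk.
by case: nok; exists k.
Qed.

Lemma push_coef_inj x k : (forall k', k' \in msupp x -> f k' = f k -> k' = k) ->
  (push x)@_(f k) = x@_k.
Proof.
move=> kP; rewrite push_coef.
rewrite (eq_big_seq (fun k' => if k' == k then x@_k else 0)) => [|k' k'x]; last first.
  case: (k' =P k) => [->|kk']; first by rewrite eqxx.
  by case: eqP => // /(kP _ k'x).
have [kx|kx] := boolP (k \in msupp x).
  rewrite (big_fsetD1 k kx) /= eqxx big1_seq ?addr0 // => k' /andP[_].
  by rewrite !inE => /andP[/negPf->].
by rewrite (mcoeff_outdom kx) big1 // => k' _; rewrite if_same.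
Qed.

End Push.

Lemma push_inj (K L : choiceType) (f : K -> L) (P : set K) (x y : {malg int[K]}) :
  {in P &, injective f} -> (forall k, k \in msupp x -> P k) ->
  (forall k, k \in msupp y -> P k) -> push f x = push f y -> x = y.
Proof.
move=> finj xP yP xy.
have co (z : {malg int[K]}) k : (forall k, k \in msupp z -> P k) -> P k ->
    (push f z)@_(f k) = z@_k.
  by move=> zP Pk; apply: push_coef_inj => k' /zP Pk' /finj; apply; exact: mem_set.
apply/malgP => k; have [Pk|nPk] := pselect (P k); first by rewrite -!co // xy.
by rewrite !mcoeff_outdom //; apply/negP => kz; apply: nPk; [exact: yP|exact: xP].
Qed.

Lemma push_comp (K L M : choiceType) (f : K -> L) (g : L -> M) x :
  push g (push f x) = push (g \o f) x.
Proof.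
have push0 : push g 0 = 0 by rewrite /push msupp0 big_seq_fset0.
rewrite {2}/push (big_morph _ (pushD g) push0); apply: eq_bigr => k _.
by rewrite (pushEw _ (D := [fset f k]%fset) msuppU_le) big_seq_fset1 mcoeffUU.
Qed.

(** * A lexicographic order on the free abelian group *)

Section Cone.
Variables (disp : Order.disp_t) (I : orderType disp).
Local Notation H := {malg int[I]}.
Implicit Types (g h : H) (i j : I).

Definition top h i := i \in msupp h /\ forall j, j \in msupp h -> (j <= i)%O.

Lemma top_uniq h i j : top h i -> top h j -> i = j.
Proof. by move=> [ih iP] [jh jP]; apply/eqP; rewrite eq_le iP ?jP. Qed.

Lemma seq_max (s : seq I) i0 : i0 \in s ->
  exists2 i, i \in s & forall j, j \in s -> (j <= i)%O.
Proof.
elim: s i0 => // k s IHs i0 _; case: s IHs => [|l s] IHs.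
  by exists k; rewrite ?mem_head // => j; rewrite inE => /eqP->.
have [|i is_ iP] := IHs l; first exact: mem_head.
exists (Order.max k i).
  by rewrite inE; case: leP => _; rewrite ?eqxx // is_ orbT.
move=> j; rewrite inE le_max => /orP[/eqP->|/iP->]; by rewrite ?lexx ?orbT.
Qed.

Lemma top_exists h i : i \in msupp h -> exists j, top h j.
Proof. by move=> /seq_max[j]; exists j. Qed.

(** The positive cone of the order in which the largest index of the support decides. *)
Definition pos h := exists2 i, top h i & 0 < h@_i.

Lemma pos0 : ~ pos 0.
Proof. by case=> i [+ _] _; rewrite msupp0. Qed.

Lemma posD g h : pos g -> pos h -> pos (g + h).
Proof.
suff half g' h' i j : top g' i -> 0 < g'@_i -> top h' j -> 0 < h'@_j -> (i <= j)%O ->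
    pos (g' + h').
  move=> [i gi g0] [j hj h0]; have [ij|/ltW ji] := leP i j; first exact: half ij.
  by rewrite addrC; exact: half ji.
move=> [ig gP] g0 [jh hP] h0 ij.
have j0 : 0 < (g' + h')@_j.
  rewrite mcoeffD; have [jg|jg] := boolP (j \in msupp g').
    have <- : i = j by apply/eqP; rewrite eq_le ij gP.
    by rewrite Num.Theory.addr_gt0 //; have -> : i = j by apply/eqP; rewrite eq_le ij gP.
  by rewrite (mcoeff_outdom jg) add0r.
exists j => //; split; first by rewrite -mcoeff_neq0; case: ltgtP j0.
move=> k /(fsubsetP (msuppD_le g' h')); rewrite in_fsetU => /orP[/gP ki|/hP //].
exact: le_trans ki ij.
Qed.

Lemma posU i : pos << i >>.
Proof.
exists i; last by rewrite mcoeffUU.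
have e : msupp (<< i >> : H) = [fset i]%fset by rewrite msuppU oner_eq0.
by split; rewrite e ?inE // => j; rewrite inE => /eqP->.
Qed.

Lemma pos_total h : h != 0 -> pos h \/ pos (- h).
Proof.
move=> h0; have [i ih] : exists i, i \in msupp h.
  apply: contrapT => noi; case/eqP: h0; apply/malgP => i.
  by rewrite mcoeff0 mcoeff_outdom //; apply/negP => ?; apply: noi; exists i.
have [j [jh jP]] := top_exists ih.
have := jh; rewrite -mcoeff_neq0 neq_lt => /orP[j0|j0]; [right|left]; exists j => //.
  by split; rewrite msuppN.
by rewrite mcoeffN Num.Theory.oppr_gt0.
Qed.

Lemma pos_maximal (T : eqType) (f : T -> H) (s : seq T) t0 : t0 \in s ->
  exists2 t, t \in s & forall u, u \in s -> ~ pos (f u - f t).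
Proof.
elim: s t0 => // t s IHs t0 _; case: s IHs => [|t1 s] IHs.
  exists t; first exact: mem_head.
  by move=> u; rewrite inE => /eqP->; rewrite subrr; exact: pos0.
have [|m ms mP] := IHs t1; first exact: mem_head.
have [tm|tm] := pselect (pos (f t - f m)).
  exists t; first exact: mem_head.
  move=> u; rewrite inE => /orP[/eqP->|us]; first by rewrite subrr; exact: pos0.
  by move=> /posD/(_ tm); rewrite addrA subrK; exact: mP.
exists m; first by rewrite inE ms orbT.
by move=> u; rewrite inE => /orP[/eqP->|/mP].
Qed.

End Cone.

(** * Commutators as double sums over supports *)

Section Commutator.
Variables (H : zmodType) (psi : H -> 'F_2).
Implicit Types (x y : {malg 'F_2[H]}).

Lemma linE (f : H -> 'F_2) x : lin f x = \sum_(g <- msupp x) f g.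
Proof.
rewrite /lin mmapE; apply: eq_big_seq => g; rewrite -mcoeff_neq0.
by case: (F2_cases x@_g) => ->; rewrite ?eqxx // mul1r.
Qed.

Lemma lin_act c (f : H -> 'F_2) x : lin f (act c false x) = lin (fun h => f (h + c)) x.
Proof.
elim/malgF2_ind: x => [|x y IHx IHy|g]; first by rewrite act0 !lin0.
  by rewrite actD !linD IHx IHy.
by rewrite actU !linU addrC.
Qed.

Lemma comm_actE c x y : comm psi x (act c false y) =
  \sum_(h <- msupp y) \sum_(g <- msupp x) (psi (h + c - g) + psi (- (h + c - g))).
Proof.
rewrite /comm {1}/beta; under eq_lin do rewrite lin_act.
rewrite /beta lin_act !linE.
under eq_bigr do rewrite linE.
rewrite exchange_big -big_split /=; apply: eq_bigr => h _.
by rewrite linE -big_split /=; apply: eq_bigr => g _; rewrite opprB.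
Qed.

End Commutator.

(** * The coloring *)

Section Coloring.
Variables (disp : Order.disp_t) (I : orderType disp).
Variables (r : I -> nat -> bool) (e : I -> I -> nat).
Hypothesis r_inj : injective r.

Local Notation H := {malg int[I]}.
(** Patterns are coded in a countable type, so that the labels can index a partition into countably
    many stationary sets. *)
Definition code_type : Type := seq (seq bool * int).
Variable l : I -> option (nat * code_type * code_type).
Implicit Types (i j x : I) (g h s : H).

Definition pre n i : seq bool := mkseq (r i) n.

Lemma take_pre n m i : (n <= m)%N -> take n (pre m i) = pre n i.
Proof.
by move=> nm; rewrite /pre /mkseq -map_take take_iota (minn_idPl nm).
Qed.

Lemma pre_le n m i j : (n <= m)%N -> pre m i = pre m j -> pre n i = pre n j.
Proof. by move=> nm ij; rewrite -(take_pre _ nm) ij take_pre. Qed.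

(* The length of the common prefix of [r i] and [r j]; 0 if [i = j]. *)
Definition delta i j : nat :=
  if pselect (exists n, r i n != r j n) is left ex then ex_minn ex else 0.

Lemma deltaP i j n : i != j -> pre n i = pre n j <-> (n <= delta i j)%N.
Proof.
move=> ij; rewrite /delta; case: pselect => [ex|noex]; last first.
  case/eqP: ij; apply: r_inj; apply/funext => k.
  by apply/eqP/negPn/negP => ?; apply: noex; exists k.
case: ex_minnP => k rk kmin; split=> [prij|nk].
  rewrite leqNgt; apply/negP => kn; case/eqP: rk.
  by have := congr1 (nth false ^~ k) prij; rewrite /= !nth_mkseq.
apply/eq_in_map => k'; rewrite mem_iota add0n => /andP[_ k'n].
apply/eqP/negPn/negP => /kmin; rewrite leqNgt => /negP; apply.
exact: leq_trans nk.
Qed.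

Lemma delta_pre m i i' j : i != j -> i' != j -> pre m i = pre m i' ->
  (delta i' j < m)%N -> delta i j = delta i' j.
Proof.
move=> ij i'j prii' lt_m; apply/eqP; rewrite eqn_leq; apply/andP; split.
  rewrite leqNgt; apply/negP => /(deltaP _ ij).
  by rewrite (pre_le lt_m prii') => /(deltaP _ i'j); rewrite ltnn.
by apply/(deltaP _ ij); rewrite (pre_le (ltnW lt_m) prii'); exact/(deltaP _ i'j).
Qed.

Definition code (p : {malg int[seq bool]}) : code_type :=
  [seq (k, p@_k) | k <- msupp p].

Lemma code_inj : injective code.
Proof.
have half p q k : code p = code q -> k \in msupp p -> p@_k = q@_k.
  move=> pq kp; have : (k, p@_k) \in code q by rewrite -pq; apply/mapP; exists k.
  by case/mapP => k' _ [-> ->].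
move=> p q pq; apply/malgP => k.
have [kp|kp] := boolP (k \in msupp p); first exact: half.
have [kq|kq] := boolP (k \in msupp q); first exact/esym/half.
by rewrite !mcoeff_outdom.
Qed.

(** What remains of [s] when each real is known only up to level [n]. *)
Definition pi n (s : H) := push (pre n) s.
Definition cut x (s : H) : H := restr (fun i => (i < x)%O) s.

Lemma piB n s t : pi n (s - t) = pi n s - pi n t.
Proof. by rewrite /pi pushD pushN. Qed.

Lemma piN n s : pi n (- s) = - pi n s.
Proof. exact: pushN. Qed.

Lemma pi_le n m s t : (n <= m)%N -> pi m s = pi m t -> pi n s = pi n t.
Proof.
move=> nm st; have take_pi u : push (take n) (pi m u) = pi n u.
  rewrite /pi push_comp; congr (push _ u); apply/funext => i.
  exact: take_pre.
by rewrite -!take_pi st.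
Qed.

Lemma cutB x s t : cut x (s - t) = cut x s - cut x t.
Proof. by rewrite /cut restrD restrN. Qed.

Lemma cutN x s : cut x (- s) = - cut x s.
Proof. exact: restrN. Qed.

Definition spread s j : nat := \max_(i <- msupp s | i != j) delta i j.

(* The least candidate is the bracket [[i, j]], for the [i] nearest to the top
   index [j] of [s]. *)
Definition cand s j x := [/\ (x <= j)%O, (e j x <= spread s j)%N &
  exists2 i, i \in msupp s & [/\ i != j, (i < x)%O & delta i j = spread s j]].

Definition marked s x := exists j,
  [/\ top s j, cand s j x & forall y, cand s j y -> (x <= y)%O].

Definition tagged s x := exists n,
  l x = Some (n, code (pi n (cut x s)), code (pi n (s - cut x s))).

Lemma tagged_eq s t x n :
  l x = Some (n, code (pi n (cut x s)), code (pi n (s - cut x s))) ->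
  pi n (cut x s) = pi n (cut x t) -> pi n s = pi n t -> tagged t x.
Proof. by move=> lx e1 e2; exists n; rewrite lx !piB e1 e2. Qed.

Definition psi s : 'F_2 := if `[< exists2 x, marked s x & tagged s x >] then 1 else 0.

(** The bracket depends only on the support, so [s] and [- s] are tested at the same ordinal. *)
Lemma markedN s x : marked (- s) x = marked s x.
Proof. by rewrite /marked /cand /top /spread msuppN. Qed.

Lemma psi_marked s x : (forall y, marked s y <-> y = x) ->
  psi s = if `[< tagged s x >] then 1 else 0.
Proof.
move=> sx; rewrite /psi; congr (if _ then _ else _); apply/asboolP/asboolP.
  by move=> [y /sx->].
by move=> tx; exists x => //; exact/sx.
Qed.

(* [Q] contains the indices of the upper element [b] of a pair; [R] is the root
   common to the whole family, and the other indices of [b] are above [d]. *)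
Section Pair.
Variables (R Q : {fset I}) (c : H) (n0 n1 m : nat) (d x0 : I).
Hypothesis RQ : (R `<=` Q)%fset.
Hypothesis Qsep : {in Q &, injective (pre n0)}.
Hypothesis Qtail : forall j, j \in Q -> j \notin R -> (d < j)%O.
Hypothesis Rhead : forall i, i \in R -> (i <= x0)%O.
Hypothesis x0d : (x0 < d)%O.
Hypothesis cR : forall i, i \in msupp c -> i \in R.
Hypothesis x0P : forall j x, j \in Q -> (x <= j)%O -> (e j x <= n0)%N ->
  (x < d)%O -> (x <= x0)%O.
Hypothesis n01 : (n0 <= n1)%N.
Hypothesis n1m : (n1 <= m)%N.
Hypothesis l_le : forall j x n p q, j \in Q -> (x <= j)%O -> (e j x <= n0)%N ->
  l x = Some (n, p, q) -> (n <= m)%N.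

(* [g] belongs to a lower element [a] of a pair, whose indices outside [R] lie in
   the gap [(x1, d1)]; [d1] is the ordinal on which the bracket will land. *)
Record side g d1 x1 : Prop := Side {
  side_x0 : (x0 <= x1)%O;
  side_x1 : (x1 < d1)%O;
  side_d : (d1 < d)%O;
  side_tail : forall i, i \in msupp g -> i \notin R -> (x1 < i < d1)%O;
  side_sep : {in (msupp g `|` R)%fset &, injective (pre n0)};
  side_delta : forall i j, i \in msupp g -> i \notin R -> j \in Q -> j \notin R ->
    (delta i j < m)%N;
  side_gap : forall j x, j \in Q -> (x <= j)%O -> (e j x <= m)%N -> (x < d1)%O ->
    (x <= x1)%O;
  side_twin : forall i, i \in msupp g -> i \notin R ->
    exists2 j, j \in Q & j \notin R /\ pre n1 i = pre n1 j;
  side_e : forall j, j \in Q -> (e j d1 <= n1)%N }.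

(** * The bracket on pairs with a fixed upper element *)

Section Target.
Variables (h : H) (j0 : I).
Hypothesis hQ : forall j, j \in msupp h -> j \in Q.
Hypothesis h_top : top h j0.
Hypothesis j0R : j0 \notin R.

Let j0h : j0 \in msupp h. Proof. by case: h_top. Qed.
Let j0Q : j0 \in Q. Proof. exact: hQ. Qed.
Let dj0 : (d < j0)%O. Proof. exact: Qtail. Qed.

Lemma side_lt g d1 x1 i : side g d1 x1 -> i \in msupp g -> (i < d1)%O.
Proof.
move=> S ig; have [iR|iR] := boolP (i \in R); last by case/andP: (side_tail S ig iR).
exact: le_lt_trans (Rhead iR) (le_lt_trans (side_x0 S) (side_x1 S)).
Qed.

Lemma side_notin_Q g d1 x1 i : side g d1 x1 -> i \in msupp g -> i \in Q -> i \in R.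
Proof.
move=> S ig iQ; apply: contraT => iR.
have := lt_trans (Qtail iQ iR) (lt_trans (side_lt S ig) (side_d S)).
by rewrite ltxx.
Qed.

(** Outside the root the supports are disjoint, that of [g] lying below [d1] and that of [h] above
    [d], and [c] is supported in the root. *)
Lemma coef_tail g d1 x1 i : side g d1 x1 -> i \notin R ->
  (h + c - g)@_i = if i \in Q then h@_i else - g@_i.
Proof.
move=> S iR; rewrite mcoeffB mcoeffD (@mcoeff_outdom _ _ c); last first.
  by apply: contra iR; exact: cR.
rewrite addr0; case: ifPn => iQ.
  rewrite (@mcoeff_outdom _ _ g) ?subr0 //.
  by apply: contra iR => ig; exact: side_notin_Q S ig iQ.
by rewrite (@mcoeff_outdom _ _ h) ?sub0r //; apply: contra iQ; exact: hQ.
Qed.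

Lemma msupp_pair g d1 x1 i : side g d1 x1 -> i \in msupp (h + c - g) ->
  [\/ i \in R, i \in msupp h /\ i \notin R | i \in msupp g /\ i \notin R].
Proof.
move=> S; have [iR|iR] := boolP (i \in R); first by constructor 1.
rewrite -mcoeff_neq0 (coef_tail S iR); case: ifP => _.
  by rewrite mcoeff_neq0; constructor 2.
by rewrite oppr_eq0 mcoeff_neq0; constructor 3.
Qed.

Lemma msupp_pair_l g d1 x1 i : side g d1 x1 -> i \in msupp h -> i \notin R ->
  i \in msupp (h + c - g).
Proof.
by move=> S ih iR; rewrite -mcoeff_neq0 (coef_tail S iR) hQ // mcoeff_neq0.
Qed.

Lemma msupp_pair_r g d1 x1 i : side g d1 x1 -> i \in msupp g -> i \notin R ->
  i \in msupp (h + c - g).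
Proof.
move=> S ig iR; rewrite -mcoeff_neq0 (coef_tail S iR); case: ifPn => iQ.
  by rewrite (side_notin_Q S ig iQ) in iR.
by rewrite oppr_eq0 mcoeff_neq0.
Qed.

Lemma top_pair g d1 x1 : side g d1 x1 -> top (h + c - g) j0.
Proof.
move=> S; split; first exact: msupp_pair_l S j0h j0R.
move=> i /(msupp_pair S)[iR|[ih _]|[ig _]].
- exact: le_trans (Rhead iR) (ltW (lt_trans x0d dj0)).
- by case: h_top => _; apply.
- exact: ltW (lt_trans (side_lt S ig) (lt_trans (side_d S) dj0)).
Qed.

Lemma delta_Q i : i \in Q -> i != j0 -> (delta i j0 < n0)%N.
Proof.
move=> iQ ij; rewrite ltnNge; apply/negP => /(deltaP _ ij) /(Qsep iQ j0Q) ij'.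
by rewrite ij' eqxx in ij.
Qed.

Lemma side_neq g d1 x1 i : side g d1 x1 -> i \in msupp g -> i != j0.
Proof.
move=> S ig; apply/eqP => ij; move: (side_notin_Q S ig); rewrite ij => /(_ j0Q).
by rewrite (negPf j0R).
Qed.

(** The case in which the index nearest to [j0] comes from the lower element. *)
Definition matched g := exists2 i, i \in msupp g & i \notin R /\ pre n0 i = pre n0 j0.

(** The index [i] of [g] imitating [j0] is nearest to it, with branching level between [n1] and [m].
    This admits [d1], as [e j0 d1 <= n1]. A smaller candidate would lie above [i], hence in the gap
    [(x1, d1)], which [side_gap] excludes. *)
Lemma marked_matched g d1 x1 x : side g d1 x1 -> matched g ->
  marked (h + c - g) x <-> x = d1.
Proof.
move=> S [i ig [iR prij]].
have ij := side_neq S ig.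
have n1_delta : (n1 <= delta i j0)%N.
  have [j jQ [jR prij']] := side_twin S ig iR.
  apply/(deltaP _ ij); rewrite prij'; congr (pre n1).
  by apply: Qsep => //; rewrite -prij; apply/esym/(pre_le n01).
have others k : k \in msupp (h + c - g) -> k != j0 -> k != i -> (delta k j0 < n0)%N.
  move=> /(msupp_pair S)[kR|[kh _]|[kg kR]] kj ki.
  - exact: delta_Q (fsubsetP RQ _ kR) kj.
  - exact: delta_Q (hQ kh) kj.
  rewrite ltnNge; apply/negP => /(deltaP _ kj); rewrite -prij => prki.
  case/eqP: ki; apply: (side_sep S) => //; by rewrite in_fsetU ?kg ?ig.
have isup := msupp_pair_r S ig iR.
have spreadE : spread (h + c - g) j0 = delta i j0.
  apply/eqP; rewrite eqn_leq; apply/andP; split; last exact: leq_bigmax_seq.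
  apply/bigmax_leqP_seq => k ks kj; have [->//|ki] := eqVneq k i.
  exact: leq_trans (ltnW (others _ ks kj ki)) (leq_trans n01 n1_delta).
have lt_m := side_delta S ig iR j0Q j0R.
have /andP[x1i id1] := side_tail S ig iR.
have candd : cand (h + c - g) j0 d1.
  split; first exact: ltW (lt_trans (side_d S) dj0).
    by rewrite spreadE; exact: leq_trans (side_e S j0Q) n1_delta.
  by exists i => //; rewrite spreadE.
have cand_ge y : cand (h + c - g) j0 y -> (d1 <= y)%O.
  rewrite /cand spreadE => -[yj ey [k ks [kj ky dk]]].
  have ki : k = i.
    apply/eqP; apply: contraT => ki.
    have := leq_trans (others _ ks kj ki) (leq_trans n01 n1_delta).
    by rewrite dk ltnn.
  rewrite leNgt; apply/negP => yd1.
  have := side_gap S j0Q yj (leq_trans ey (ltnW lt_m)) yd1.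
  by rewrite leNgt (lt_trans x1i) // -ki.
split=> [[j [tj cj minj]]|->].
  have jj0 := top_uniq tj (top_pair S); subst j.
  by apply/eqP; rewrite eq_le cand_ge // andbT; exact: minj.
by exists j0; split=> //; exact: top_pair S.
Qed.

Lemma cut_pair g d1 x1 : side g d1 x1 -> cut d1 (h + c - g) = cut d h + c - g.
Proof.
move=> S; rewrite cutB /cut restrD; congr (_ + _ - _).
- apply/malgP => i; rewrite !restrE.
  have [ih|ih] := boolP (i \in msupp h); last by rewrite mcoeff_outdom ?if_same.
  have [iR|iR] := boolP (i \in R).
    rewrite (le_lt_trans (Rhead iR) x0d).
    by rewrite (le_lt_trans (Rhead iR) (le_lt_trans (side_x0 S) (side_x1 S))).
  have di := Qtail (hQ ih) iR.
  by rewrite !ltNge (ltW di) (ltW (lt_trans (side_d S) di)).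
- apply: restr_id => i /cR/Rhead ix0.
  exact: le_lt_trans ix0 (le_lt_trans (side_x0 S) (side_x1 S)).
- by apply: restr_id => i; exact: side_lt S.
Qed.

Lemma root_coef g g' d1 x1 d1' x1' i : side g d1 x1 -> side g' d1' x1' ->
  pi m g = pi m g' -> i \in R -> g@_i = g'@_i.
Proof.
move=> S S' gg' iR.
have co g1 d2 x2 : side g1 d2 x2 -> (pi m g1)@_(pre m i) = g1@_i.
  move=> S1; apply: push_coef_inj => k kg /(pre_le (leq_trans n01 n1m)).
  by apply: (side_sep S1); rewrite in_fsetU ?kg ?iR ?orbT.
by rewrite -(co _ _ _ S) gg' (co _ _ _ S').
Qed.

Lemma twin g g' d1 x1 d1' x1' i : side g d1 x1 -> side g' d1' x1' ->
  pi m g = pi m g' -> i \in msupp g -> i \notin R ->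
  exists2 i', i' \in msupp g' & i' \notin R /\ pre m i = pre m i'.
Proof.
move=> S S' gg' ig iR; have n0m := leq_trans n01 n1m.
have : (pi m g)@_(pre m i) != 0.
  rewrite /pi push_coef_inj ?mcoeff_neq0 // => k kg /(pre_le n0m).
  by apply: (side_sep S); rewrite in_fsetU ?kg ?ig.
rewrite gg' => /push_supp[i' i'g prii']; exists i' => //; split=> //.
apply: contra iR => i'R; suff -> : i = i' by [].
apply: (side_sep S); rewrite ?in_fsetU ?ig ?i'R ?orbT //.
exact/(pre_le n0m).
Qed.

Lemma twin_delta g d1 x1 g' d1' x1' i i' : side g d1 x1 -> side g' d1' x1' ->
  i \in msupp g -> i' \in msupp g' -> i' \notin R -> pre m i = pre m i' ->
  delta i j0 = delta i' j0.
Proof.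
move=> S S' ig i'g i'R prii'; apply: (delta_pre (m := m)) => //.
- exact: side_neq S ig.
- exact: side_neq S' i'g.
- exact: (side_delta S' i'g i'R j0Q j0R).
Qed.

Lemma root_msupp g g' d1 x1 d1' x1' i : side g d1 x1 -> side g' d1' x1' ->
  pi m g = pi m g' -> i \in R -> i \in msupp (h + c - g) ->
  i \in msupp (h + c - g').
Proof.
move=> S S' gg' iR; rewrite -!mcoeff_neq0 !mcoeffB.
by rewrite (root_coef S S' gg' iR).
Qed.

Lemma spread_twin_le g g' d1 x1 d1' x1' : side g d1 x1 -> side g' d1' x1' ->
  pi m g = pi m g' -> (spread (h + c - g) j0 <= spread (h + c - g') j0)%N.
Proof.
move=> S S' gg'; apply/bigmax_leqP_seq => i is_ ij.
have [iR|[ih iR]|[ig iR]] := msupp_pair S is_.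
- apply: leq_bigmax_seq => //; exact: root_msupp S S' gg' iR is_.
- apply: leq_bigmax_seq => //; exact: msupp_pair_l S' ih iR.
have [i' i'g [i'R prii']] := twin S S' gg' ig iR.
rewrite (twin_delta S S' ig i'g i'R prii').
by apply: (leq_bigmax_seq i'); [exact: msupp_pair_r S' i'g i'R|exact: side_neq S' i'g].
Qed.

Lemma spread_twin g g' d1 x1 d1' x1' : side g d1 x1 -> side g' d1' x1' ->
  pi m g = pi m g' -> spread (h + c - g) j0 = spread (h + c - g') j0.
Proof.
move=> S S' gg'; apply/eqP.
by rewrite eqn_leq (spread_twin_le S S' gg') (spread_twin_le S' S (esym gg')).
Qed.

Lemma spread_unmatched g d1 x1 : side g d1 x1 -> ~ matched g ->
  (spread (h + c - g) j0 <= n0)%N.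
Proof.
move=> S nm; apply/bigmax_leqP_seq => i is_ ij.
have [iR|[ih iR]|[ig iR]] := msupp_pair S is_.
- exact: ltnW (delta_Q (fsubsetP RQ _ iR) ij).
- exact: ltnW (delta_Q (hQ ih) ij).
rewrite leqNgt; apply/negP => /ltnW/(deltaP _ ij) prij.
by apply: nm; exists i.
Qed.

Lemma unmatched_twin g g' d1 x1 d1' x1' : side g d1 x1 -> side g' d1' x1' ->
  pi m g = pi m g' -> ~ matched g -> ~ matched g'.
Proof.
move=> S S' gg' nm [i' i'g [i'R prij]]; apply: nm.
have [i ig [iR prii']] := twin S' S (esym gg') i'g i'R.
exists i => //; split=> //; rewrite -prij.
exact/esym/(pre_le (leq_trans n01 n1m)).
Qed.

Lemma cand_twin g g' d1 x1 d1' x1' x : side g d1 x1 -> side g' d1' x1' ->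
  pi m g = pi m g' -> ~ matched g -> cand (h + c - g) j0 x -> cand (h + c - g') j0 x.
Proof.
move=> S S' gg' nm [xj ex [i is_ [ij ix di]]].
rewrite /cand -(spread_twin S S' gg'); split=> //.
have [iR|[ih iR]|[ig iR]] := msupp_pair S is_.
- by exists i => //; exact: root_msupp S S' gg' iR is_.
- by exists i => //; exact: msupp_pair_l S' ih iR.
have [i' i'g [i'R prii']] := twin S S' gg' ig iR.
exists i'; first exact: msupp_pair_r S' i'g i'R.
split; [exact: side_neq S' i'g| |by rewrite -(twin_delta S S' ig i'g i'R prii')].
(* A candidate above a tail index of [g] exceeds [x0]; its [e]-value is at most [n0], so by [x0P] it
   is not below [d]. *)
have dx : (d <= x)%O.
  rewrite leNgt; apply/negP => xd.
  have := x0P j0Q xj (leq_trans ex (spread_unmatched S nm)) xd.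
  case/andP: (side_tail S ig iR) => x1i _.
  by rewrite leNgt (lt_trans (le_lt_trans (side_x0 S) x1i) ix).
exact: lt_le_trans (lt_trans (side_lt S' i'g) (side_d S')) dx.
Qed.

Lemma marked_twin g g' d1 x1 d1' x1' x : side g d1 x1 -> side g' d1' x1' ->
  pi m g = pi m g' -> ~ matched g -> marked (h + c - g) x -> marked (h + c - g') x.
Proof.
move=> S S' gg' nm [j [tj cj minj]].
have jj0 := top_uniq tj (top_pair S); subst j.
exists j0; split; [exact: top_pair S'|exact: cand_twin S S' gg' nm cj|].
move=> y cy; apply: minj.
exact: cand_twin S' S (esym gg') (unmatched_twin S S' gg' nm) cy.
Qed.

Lemma pi_cut_twin g g' d1 x1 d1' x1' x n p q : side g d1 x1 -> side g' d1' x1' ->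
  pi m g = pi m g' -> ~ matched g -> marked (h + c - g) x -> l x = Some (n, p, q) ->
  pi n (cut x (h + c - g)) = pi n (cut x (h + c - g')) /\
  pi n (h + c - g) = pi n (h + c - g').
Proof.
move=> S S' gg' nm [j [tj [xj ex _] _]] lx.
have jj0 := top_uniq tj (top_pair S); subst j.
have {}ex := leq_trans ex (spread_unmatched S nm).
have nm' := l_le j0Q xj ex lx.
have pg : pi n g = pi n g' := pi_le nm' gg'.
rewrite !cutB !piB pg; split=> //; congr (_ - _).
(* From [d] on, the cut keeps [g] and [g'] whole. Below [d] the ordinal is at most [x0], so only
   root indices survive, and there the coefficients agree. *)
have [xd|dx] := ltP x d; last first.
  rewrite /cut !restr_id // => i ig.
    exact: lt_le_trans (lt_trans (side_lt S' ig) (side_d S')) dx.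
  exact: lt_le_trans (lt_trans (side_lt S ig) (side_d S)) dx.
have xx0 := x0P j0Q xj ex xd.
congr (pi n _); apply/malgP => i; rewrite /cut !restrE; case: ifP => // ix.
have [iR|iR] := boolP (i \in R); first exact: root_coef S S' gg' iR.
have out g1 d2 x2 : side g1 d2 x2 -> i \notin msupp g1.
  move=> S1; apply/negP => ig; case/andP: (side_tail S1 ig iR) => x1i _.
  have := lt_trans (lt_le_trans ix xx0) (le_lt_trans (side_x0 S1) x1i).
  by rewrite ltxx.
by rewrite !mcoeff_outdom; [|exact: out S'|exact: out S].
Qed.

(** The spread is at most [n0], too small for the bracket to land in the region where [g] and [g']
    differ; both are tested at the same ordinal with the same outcome. *)
Lemma psi_unmatched g g' d1 x1 d1' x1' : side g d1 x1 -> side g' d1' x1' ->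
  pi m g = pi m g' -> ~ matched g ->
  psi (h + c - g) = psi (h + c - g') /\ psi (- (h + c - g)) = psi (- (h + c - g')).
Proof.
have half g1 g2 d2 x2 d3 x3 : side g1 d2 x2 -> side g2 d3 x3 ->
    pi m g1 = pi m g2 -> ~ matched g1 ->
    ((exists2 x, marked (h + c - g1) x & tagged (h + c - g1) x) ->
     exists2 x, marked (h + c - g2) x & tagged (h + c - g2) x) /\
    ((exists2 x, marked (- (h + c - g1)) x & tagged (- (h + c - g1)) x) ->
     exists2 x, marked (- (h + c - g2)) x & tagged (- (h + c - g2)) x).
  move=> S S' gg nm; split=> -[x mx [n lx]].
    have [e1 e2] := pi_cut_twin S S' gg nm mx lx.
    exists x; first exact: marked_twin S S' gg nm mx.
    exact: tagged_eq lx e1 e2.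
  rewrite markedN in mx.
  have [e1 e2] := pi_cut_twin S S' gg nm mx lx.
  exists x; first by rewrite markedN; exact: marked_twin S S' gg nm mx.
  by apply: (tagged_eq lx); rewrite ?cutN !piN ?e1 ?e2.
move=> S S' gg' nm.
have nm' := unmatched_twin S S' gg' nm.
have [a1 a2] := half _ _ _ _ _ _ S S' gg' nm.
have [b1 b2] := half _ _ _ _ _ _ S' S (esym gg') nm'.
by rewrite /psi; split; congr (if _ then _ else _); apply/asboolP/asboolP.
Qed.

End Target.
Definition tl h : H := h - cut d h.

Lemma tlE h i : (tl h)@_i = if (i < d)%O then 0 else h@_i.
Proof. by rewrite mcoeffB restrE; case: ifP; rewrite ?subrr ?subr0. Qed.

Lemma tlB g h : tl (g - h) = tl g - tl h.
Proof. by apply/malgP => i; rewrite !(tlE, mcoeffB); case: ifP; rewrite ?subrr. Qed.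

Lemma tlD g h : tl (g + h) = tl g + tl h.
Proof. by apply/malgP => i; rewrite !(tlE, mcoeffD); case: ifP; rewrite ?addr0. Qed.

Lemma tlc : tl c = 0.
Proof.
apply/malgP => i; rewrite tlE mcoeff0; case: ifPn => // id.
rewrite mcoeff_outdom //; apply: contra id => /cR/Rhead ix0.
exact: le_lt_trans ix0 x0d.
Qed.

Definition inQ h := forall i, i \in msupp h -> i \in Q.

Lemma inQB g h : inQ g -> inQ h -> inQ (g - h).
Proof.
move=> gQ hQ i /(fsubsetP (msuppB_le g h)); rewrite in_fsetU => /orP[].
  exact: gQ.
exact: hQ.
Qed.

Lemma inQN h : inQ h -> inQ (- h).
Proof. by move=> hQ i; rewrite msuppN; exact: hQ. Qed.

Lemma inQD g h : inQ g -> inQ h -> inQ (g + h).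
Proof. by move=> gQ hQ; rewrite -[h]opprK; apply: inQB => //; exact: inQN. Qed.

Lemma inQ_cut x h : inQ h -> inQ (cut x h).
Proof. by move=> hQ i; rewrite msupp_restr => /andP[/hQ]. Qed.

Lemma inQc : inQ c.
Proof. by move=> i /cR; exact: (fsubsetP RQ). Qed.

Lemma inQ_tl h : inQ h -> inQ (tl h).
Proof. by move=> hQ; apply: inQB => //; exact: inQ_cut. Qed.

Lemma pi_inj g h : inQ g -> inQ h -> pi n0 g = pi n0 h -> g = h.
Proof.
apply: (push_inj (P := [set` Q])) => i j /set_mem iQ /set_mem jQ.
exact: Qsep.
Qed.

Lemma tl_neq0 h : inQ h -> (tl h != 0) = ~~ (msupp h `<=` R)%fset.
Proof.
move=> hQ; apply/idP/idP => [|/fsubsetPn[i ih iR]]; last first.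
  apply/eqP => /(congr1 (fun s : H => s@_i)); rewrite tlE mcoeff0 ltNge.
  by rewrite (ltW (Qtail (hQ _ ih) iR)) /= => /eqP; rewrite mcoeff_eq0 ih.
apply: contra => /fsubsetP hR; apply/eqP/malgP => i; rewrite tlE mcoeff0.
case: ifPn => // id; apply: mcoeff_outdom; apply: contra id => /hR/Rhead ix0.
exact: le_lt_trans ix0 x0d.
Qed.

Section Selection.
(* The pattern comes from a pair [(g0, h0)] with equal tails for which [h0 - g0] is
   maximal: this is the only pair of [b] with that difference, and a pair matched
   after a change of sign would have difference [h0 - g0 + 2c]. *)
Variables (b : {malg 'F_2[H]}) (g0 h0 : H).
Hypothesis c_pos : pos c.
Hypothesis bQ : forall h, h \in msupp b -> inQ h.
Hypothesis g0b : g0 \in msupp b.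
Hypothesis h0b : h0 \in msupp b.
Hypothesis tl00 : tl g0 = tl h0.
Hypothesis tlh0 : tl h0 != 0.
Hypothesis maxP : forall g h, g \in msupp b -> h \in msupp b -> tl g = tl h ->
  tl h != 0 -> ~ pos ((h - g) - (h0 - g0)).
Variables (d1 x1 : I).
Hypothesis ld1 : l d1 =
  Some (n0, code (pi n0 (cut d h0 + c - g0)), code (pi n0 (tl h0))).

Lemma tagged_pairP g g' h j : side g d1 x1 -> g' \in msupp b ->
  pi n0 g = pi n0 g' -> h \in msupp b -> top h j -> j \notin R ->
  tagged (h + c - g) d1 <-> h = h0 /\ g' = g0.
Proof.
move=> S g'b gg' hb hj jR; have hQ := bQ hb; have g'Q := bQ g'b.
have cutE : cut d1 (h + c - g) = cut d h + c - g.
  exact: (cut_pair hQ S).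
rewrite /tagged cutE.
have -> : h + c - g - (cut d h + c - g) = tl h.
  by rewrite opprB addrA subrK opprD addrACA subrr addr0.
have piE : pi n0 (cut d h + c - g) = pi n0 (cut d h + c - g') by rewrite !piB gg'.
split=> [[n]|[-> eg']]; last by exists n0; rewrite ld1 !piB gg' eg'.
rewrite ld1 => -[<- /code_inj + /code_inj]; rewrite piE => hg /esym htl.
have {}htl : tl h = tl h0 by apply: pi_inj => //; apply: inQ_tl => //; exact: bQ.
have {}hg : cut d h0 + c - g0 = cut d h + c - g'.
  apply: pi_inj => //; apply: inQB; try exact: bQ; try (apply: inQD; last exact: inQc).
    by apply: inQ_cut; exact: bQ.
  by apply: inQ_cut.
have hgE : h - g' = h0 - g0.
  apply/malgP => k.
  move: (congr1 (fun s : H => s@_k) hg) (congr1 (fun s : H => s@_k) htl).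
  by rewrite /= !(mcoeffD, mcoeffN); lia.
have tlg' : tl g' = tl h.
  apply/eqP; rewrite eq_sym -subr_eq0 -tlB hgE tlB tl00 subrr //.
suff hh0 : h = h0.
  split=> //; apply: oppr_inj; apply: (addrI h0); rewrite -hgE hh0 //.
(* If [h] were larger than [h0], the pair [(g0, h)] would beat the maximal one; if smaller,
   [(g', h0)] would. *)
apply/eqP; rewrite -subr_eq0; apply/negP => /negP /pos_total[].
  have := maxP g0b hb (etrans tl00 (esym htl)); rewrite htl => /(_ tlh0).
  by rewrite opprB addrA addrNK.
have := maxP g'b h0b (etrans tlg' htl) tlh0; rewrite -hgE.
by rewrite !opprB addrA addrNK.
Qed.

Lemma tagged_pairN g g' h j : side g d1 x1 -> g' \in msupp b ->
  pi n0 g = pi n0 g' -> h \in msupp b -> top h j -> j \notin R ->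
  ~ tagged (- (h + c - g)) d1.
Proof.
move=> S g'b gg' hb hj jR; have hQ := bQ hb; have g'Q := bQ g'b.
rewrite /tagged cutN (cut_pair hQ S) ld1 => -[n].
have -> : - (h + c - g) - - (cut d h + c - g) = - tl h.
  by apply/malgP => k; rewrite !(mcoeffD, mcoeffN); lia.
move=> -[<- /code_inj hg /code_inj htl].
have {}htl : tl h0 = - tl h.
  by apply: pi_inj => //; [exact: inQ_tl (bQ h0b)|apply/inQN/inQ_tl].
have {}hg : cut d h0 + c - g0 = - (cut d h + c - g').
  apply: pi_inj; last by rewrite hg !(piN, piB) gg'.
    by apply: inQB (bQ g0b); apply: inQD inQc; exact: inQ_cut (bQ h0b).
  by apply: inQN; apply: inQB => //; apply: inQD inQc; exact: inQ_cut.
(* The pair [(h, g')] would exceed the maximal difference by [c + c], which is positive. *)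
have ghE : g' - h - (h0 - g0) = c + c.
  apply/malgP => k.
  move: (congr1 (fun s : H => s@_k) hg) (congr1 (fun s : H => s@_k) htl).
  by rewrite /= !(mcoeffD, mcoeffN); lia.
have tlg' : tl g' = tl h.
  have := congr1 tl ghE; rewrite !tlB tlD tlc addr0 tl00 subrr subr0.
  by move/eqP; rewrite subr_eq0 => /eqP.
have tlh : tl g' != 0.
  by apply: contra tlh0 => /eqP e0; rewrite htl -tlg' e0 oppr0.
apply: (maxP hb g'b (esym tlg') tlh); rewrite ghE; exact: posD.
Qed.

Lemma psi_matched g g' h j : side g d1 x1 -> g' \in msupp b ->
  pi n0 g = pi n0 g' -> h \in msupp b -> top h j -> j \notin R -> matched j g ->
  psi (h + c - g) + psi (- (h + c - g)) =
  if (h == h0) && (g' == g0) then 1 else 0.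
Proof.
move=> S g'b gg' hb hj jR gj.
have mk y := marked_matched (bQ hb) hj jR y S gj.
rewrite (psi_marked mk) (@psi_marked (- (h + c - g)) d1); last first.
  by move=> y; rewrite markedN.
have tag := tagged_pairP S g'b gg' hb hj jR.
have tagN := tagged_pairN S g'b gg' hb hj jR.
rewrite [in X in _ + X]asboolF // addr0.
by congr (if _ then _ else _); apply/asboolP/andP => [/tag[-> ->]|[/eqP? /eqP?]] //;
  apply/tag.
Qed.

Lemma psi_matched_none g h j d2 x2 : side g d2 x2 -> l d2 = None -> inQ h ->
  top h j -> j \notin R -> matched j g ->
  psi (h + c - g) + psi (- (h + c - g)) = 0.
Proof.
move=> S ld2 hQ hj jR gj; have mk y := marked_matched hQ hj jR y S gj.
rewrite (psi_marked mk) (@psi_marked (- (h + c - g)) d2); last first.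
  by move=> y; rewrite markedN.
by rewrite !asboolF ?addr0 // => -[n]; rewrite ld2.
Qed.

Lemma top_tail h : inQ h -> tl h != 0 -> exists2 j, top h j & j \notin R.
Proof.
move=> hQ; rewrite tl_neq0 // => /fsubsetPn[i ih iR].
have [j hj] := top_exists ih; exists j => //.
apply/negP => jR; have := hj.2 i ih; rewrite leNgt (lt_trans _ (Qtail (hQ i ih) iR)) //.
exact: le_lt_trans (Rhead jR) x0d.
Qed.

(** Equality of tails puts the top index [j] of [h0] into the support of [g0], and [g] looks like
    [g0]. *)
Lemma matched_max g j : pi n0 g = pi n0 g0 -> top h0 j -> j \notin R -> matched j g.
Proof.
move=> gg0 h0j jR; have jQ := bQ h0b h0j.1.
have jd : (j < d)%O = false by rewrite ltNge (ltW (Qtail jQ jR)).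
have jg0 : g0@_j != 0.
  have := congr1 (fun s : H => s@_j) tl00; rewrite /= !tlE jd => ->.
  by rewrite mcoeff_neq0; exact: h0j.1.
have : (pi n0 g)@_(pre n0 j) != 0.
  rewrite gg0 /pi push_coef_inj // => k kg0 prkj.
  by apply: Qsep => //; exact: bQ kg0.
move=> /push_supp[i ig prij]; exists i => //; split=> //.
by apply: contra jR => iR; rewrite -(Qsep (fsubsetP RQ _ iR) jQ prij).
Qed.

Lemma sum_delta (T : choiceType) (D : {fset T}) (p : pred T) t0 :
  t0 \in D -> p t0 ->
  \sum_(t <- D | p t) (if t == t0 then 1 else 0 : 'F_2) = 1.
Proof.
move=> t0D pt0; rewrite big_mkcond (big_fsetD1 t0 t0D) /= pt0 eqxx big1_seq ?addr0 //.
by move=> t /andP[_]; rewrite !inE => /andP[/negPf-> _]; rewrite if_same.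
Qed.

(** The root part [w] of [b] contributes equally to both commutators. Elsewhere unmatched terms
    cancel against their twins; matched terms vanish for [a'], as [d2] has no pattern, and for [a]
    only the pair imitating [(g0, h0)] gives 1. *)
Lemma comm_pair_sum (a a' w : {malg 'F_2[H]}) d2 x2 :
  (forall g, g \in msupp a -> side g d1 x1) ->
  (forall g, g \in msupp a' -> side g d2 x2) -> l d2 = None ->
  {in msupp a &, injective (pi n0)} -> {in msupp a' &, injective (pi n0)} ->
  (forall g, g \in msupp a -> exists2 g', g' \in msupp a' & pi m g = pi m g') ->
  (forall g', g' \in msupp a' -> exists2 g, g \in msupp a & pi m g = pi m g') ->
  (forall g, g \in msupp a -> exists2 g', g' \in msupp b & pi n1 g = pi n1 g') ->
  (forall g', g' \in msupp b -> exists2 g, g \in msupp a & pi n1 g = pi n1 g') ->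
  restr (fun h => msupp h `<=` R)%fset b = w ->
  comm psi a (act c false w) = comm psi a' (act c false w) ->
  comm psi a (act c false b) + comm psi a' (act c false b) = 1.
Proof.
move=> Sa Sa' ld2 inja inja' aa' a'a ab ba bw eqw.
have n0m := leq_trans n01 n1m.
(* The twin map [si] will be a bijection between the supports, since level [n0] separates the
   elements of each. *)
have /choice[si siP] : forall g, exists g', g \in msupp a ->
    g' \in msupp a' /\ pi m g = pi m g'.
  move=> g; have [ga|ga] := boolP (g \in msupp a); last by exists 0.
  by have [g' g'a gg'] := aa' g ga; exists g'.
have reindex (f : H -> 'F_2) :
    \sum_(g <- msupp a') f g = \sum_(g <- msupp a) f (si g).
  rewrite -(big_map si xpredT f); apply: perm_big; apply: uniq_perm; [exact: fset_uniq| |].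
    rewrite map_inj_in_uniq ?fset_uniq // => g1 g2 g1a g2a e12; apply: inja => //.
    by apply: (pi_le n0m); rewrite (siP _ g1a).2 (siP _ g2a).2 e12.
  move=> g'; apply/idP/mapP => [g'a|[g ga ->]]; last exact: (siP _ ga).1.
  have [g ga gg'] := a'a g' g'a; exists g => //.
  apply: inja' => //; first exact: (siP _ ga).1.
  by apply: (pi_le n0m); rewrite -gg' (siP _ ga).2.
pose phi s : 'F_2 := psi s + psi (- s).
have commE y : comm psi a (act c false y) + comm psi a' (act c false y) =
    \sum_(h <- msupp y) \sum_(g <- msupp a) (phi (h + c - g) + phi (h + c - si g)).
  rewrite !comm_actE -big_split; apply: eq_bigr => h _.
  by rewrite reindex -big_split.
have [gs gsa gs0] := ba g0 g0b.
rewrite commE (bigID (fun h => msupp h `<=` R)%fset) /=.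
rewrite [X in X + _](_ : _ = 0) ?add0r; last first.
  transitivity (comm psi a (act c false w) + comm psi a' (act c false w)).
    rewrite commE -big_filter; apply: perm_big; apply: uniq_perm.
    - exact/filter_uniq/fset_uniq.
    - exact: fset_uniq.
    - by move=> h; rewrite mem_filter -bw msupp_restr andbC.
  by rewrite eqw addFF.
rewrite -[RHS](@sum_delta _ (msupp b) (fun h => ~~ (msupp h `<=` R)%fset) h0) //; last first.
  by rewrite -tl_neq0 //; exact: bQ.
rewrite big_seq_cond [RHS]big_seq_cond; apply: eq_bigr => h /andP[hb hR].
have hQ := bQ hb; rewrite -tl_neq0 // in hR.
have [j hj jR] := top_tail hQ hR.
transitivity (\sum_(g <- msupp a) (if (h == h0) && (g == gs) then 1 else 0 : 'F_2)).
  apply: eq_big_seq => g ga; have [sga gsg] := siP g ga.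
  have Sg := Sa g ga; have Ssg := Sa' _ sga.
  have [gj|gj] := pselect (matched j g).
    have [g' g'b gg'] := ab g ga.
    have g0g' : pi n0 g = pi n0 g' := pi_le n01 gg'.
    rewrite /phi (psi_matched Sg g'b g0g' hb hj jR gj).
    rewrite (psi_matched_none Ssg ld2 hQ hj jR); last first.
      apply: contrapT => ngj; apply: (unmatched_twin Ssg Sg _ ngj gj).
      by rewrite gsg.
    rewrite addr0; congr (if _ && _ then _ else _); apply/eqP/eqP => [g'0|ggs].
      by apply: inja => //; rewrite g0g' g'0; exact/esym/(pi_le n01).
    apply: pi_inj; [exact: bQ|exact: bQ|].
    by rewrite -g0g' ggs; exact: (pi_le n01).
  rewrite /phi; have [-> ->] := psi_unmatched hQ hj jR Sg Ssg gsg gj.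
  rewrite addFF; case: andP => // -[/eqP hh0 /eqP ggs].
  case: gj; rewrite hh0 in hj; apply: matched_max hj jR.
  by rewrite ggs; exact: (pi_le n01).
case: (h =P h0) => _ /=; last by rewrite big1.
exact: sum_delta.
Qed.

End Selection.

End Pair.

End Coloring.

(** * Uncountable families *)

Section Family.
Variables (disp : Order.disp_t) (I : orderType disp).
Hypothesis I_wf : forall A : set I, A !=set0 ->
  exists2 m, A m & forall i, A i -> (m <= i)%O.
Hypothesis I_seg : forall i : I, countable [set j : I | (j < i)%O].
Hypothesis I_unc : ~ countable [set: I].
Variables (r : I -> nat -> bool) (e : I -> I -> nat).
Hypothesis r_inj : injective r.
Hypothesis e_inj : forall j i i' : I,
  (i <= j)%O -> (i' <= j)%O -> e j i = e j i' -> i = i'.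
Local Notation H := {malg int[I]}.
Local Notation X := {malg 'F_2[H]}.
Variable l : I -> option (nat * code_type * code_type).
Hypothesis l_stat : forall a, stationary [set i | l i = a].
Variable i0 : I.
Local Notation c := (<< i0 >> : H).
Local Notation psi := (psi r e l).
Local Notation pre := (pre r).
Local Notation pi := (pi r).
Implicit Types (u : X) (A B : set X) (R Q : {fset I}) (i j x : I).

Definition indices u : {fset I} := (\bigcup_(h <- msupp u) msupp h)%fset.

Lemma indicesP u i : reflect (exists2 h, h \in msupp u & i \in msupp h) (i \in indices u).
Proof.
apply: (iffP (bigfcupP _ _ _ _)) => [[h]|[h hu ih]]; first by rewrite andbT; exists h.
by exists h; rewrite ?andbT.
Qed.

Lemma countable_indices (S : set I) : countable S ->
  countable [set u | forall i, i \in indices u -> S i].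
Proof.
move=> Sc; have Hc := countable_malg Sc (countableP [set: int]).
apply: (countable_sub _ (countable_malg Hc (countableP [set: 'F_2]))) => u uS h hu i ih.
by apply: uS; apply/indicesP; exists h.
Qed.

(* [R] is of maximal size among the sets contained in uncountably many [indices u]. *)
Lemma delta_root A : ~ countable A -> exists R B,
  [/\ B `<=` A, ~ countable B &
    forall i, i \notin R -> countable (B `&` [set u | i \in indices u])].
Proof.
move=> Aunc.
have [n] := uncountable_fibre Aunc (countableP [set: nat])
  (fun u _ => Logic.I : [set: nat] #|` indices u|).
set An := A `&` _ => Anunc.
pose P k := `[< exists R, #|` R| = k /\
  ~ countable (An `&` [set u | (R `<=` indices u)%fset]) >].
have exP : exists k, P k.
  exists 0%N; apply/asboolP; exists fset0; split; first exact: cardfs0.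
  by apply: contra_not Anunc; apply: countable_sub => u Au; split => //=; exact: fsub0set.
have leP : forall k, P k -> (k <= n)%N.
  move=> k /asboolP[R [<- /uncountable_nonempty[u [[_ <-] Ru]]]].
  exact: fsubset_leq_card.
case: (ex_maxnP exP leP) => k /asboolP[R [Rk Runc]] kmax.
exists R, (An `&` [set u | (R `<=` indices u)%fset]); split=> [u [[]]//|//|i iR].
apply: contrapT => iunc; have : P k.+1; last by move=> /kmax; rewrite ltnn.
apply/asboolP; exists (i |` R)%fset; split; first by rewrite cardfsU1 iR Rk.
apply: contra_not iunc; apply: countable_sub => u [[Au Ru] iu]; split=> //=.
by rewrite fsubUset Ru fsub1set iu.
Qed.

Lemma separating_level Q : exists n, {in Q &, injective (pre n)}.
Proof.
pose n := (\max_(i <- Q) \max_(j <- Q) (delta r i j).+1)%N.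
exists n => i j iQ jQ; apply: contra_eq => ij; apply/eqP => /(deltaP r_inj _ ij).
rewrite leqNgt => /negP; apply; apply: leq_trans (leq_bigmax_seq i iQ isT).
exact: (leq_bigmax_seq j jQ isT).
Qed.

(** The outcome of a Delta-system argument followed by thinning out: data with countably many
    possible values are made constant on an uncountable family. *)
Record homogeneous B R n0 (w : X) : Prop := Homogeneous {
  hom_unc : ~ countable B;
  hom_root : forall i, i \notin R -> countable (B `&` [set u | i \in indices u]);
  hom_sep : forall u, B u -> {in (indices u `|` R)%fset &, injective (pre n0)};
  hom_restr : forall u, B u -> restr (fun h => msupp h `<=` R)%fset u = w;
  hom_comm : forall u u', B u -> B u' ->
    comm psi u (act c false w) = comm psi u' (act c false w) }.

Lemma homogeneous_exists A : ~ countable A ->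
  exists R n0 w B, [/\ B `<=` A, i0 \in R & homogeneous B R n0 w].
Proof.
(* The root is enlarged by [i0] so that it supports [c]. *)
move=> /delta_root[R0 [B0 [B0A B0unc B0R]]]; pose R := (i0 |` R0)%fset.
have {}B0R i : i \notin R -> countable (B0 `&` [set u | i \in indices u]).
  by rewrite !inE negb_or => /andP[_]; exact: B0R.
have /choice[lev levP] : forall u, exists n,
    {in (indices u `|` R)%fset &, injective (pre n)}.
  by move=> u; exact: separating_level.
have [n0 B1unc] := uncountable_fibre B0unc (countableP [set: nat])
  (fun u _ => Logic.I : [set: nat] (lev u)).
pose root u := restr (fun h => msupp h `<=` R)%fset u.
have rootc : countable [set u | forall i, i \in indices u -> i \in R].
  exact/countable_indices/countable_fset.
have rootP u : forall i, i \in indices (root u) -> i \in R.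
  move=> i /indicesP[h]; rewrite msupp_restr => /andP[_ /fsubsetP]; exact.
have [w B2unc] := uncountable_fibre B1unc rootc (fun u _ => rootP u).
have [k B3unc] := uncountable_fibre B2unc (countableP [set: 'F_2])
  (fun u _ => Logic.I : [set: 'F_2] (comm psi u (act c false w))).
exists R, n0, w; eexists; split; [| |split; first exact: B3unc].
- by move=> u [[[/B0A]]].
- by rewrite !inE eqxx.
- move=> i /B0R; apply: countable_sub => u [[[[? _] _] _] ?]; by split.
- by move=> u [[[_ <-] _] _]; exact: levP.
- by move=> u [[_ <-] _].
- by move=> u u' [_ ->] [_ ->].
Qed.

(** Only countably many members of [B] have an index outside [R] that is at most [x]. *)
Lemma tail_above B R n0 w K x : homogeneous B R n0 w -> K `<=` B -> ~ countable K ->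
  exists2 u, K u & forall i, i \in indices u -> i \notin R -> (x < i)%O.
Proof.
move=> hom KB Kunc.
pose D := [set i | (i <= x)%O /\ i \notin R].
have Dc : countable (\bigcup_(i in D) (B `&` [set u | i \in indices u])).
  apply: bigcup_countable => [|i [_]]; last exact: hom_root hom _.
  by apply: (countable_sub _ (countable_le I_seg x)) => i [].
have [u [Ku uD]] := uncountable_nonempty (uncountable_setD Kunc Dc).
exists u => // i iu iR; rewrite ltNge; apply/negP => ix; apply: uD.
by exists i => //; split=> //; exact: KB.
Qed.

Lemma nat_bound (S : set nat) : finite_set S -> exists n, forall k, S k -> (k <= n)%N.
Proof.
move=> /finite_seqP[s ->]; exists (\max_(k <- s) k)%N => k /= ks.
exact: (leq_bigmax_seq (F := id) k ks isT).
Qed.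

Lemma anticommuting A : ~ countable A ->
  exists u u', [/\ A u, A u' & comm psi u (act c false u') = 1].
Proof.
move=> /homogeneous_exists[R [n0 [w [B [BA i0R hom]]]]].
pose typ n u := [set pi n h | h in [set` msupp u]].
pose C := [set: nat] `*` [set t : set {malg int[seq bool]} | t `<=` setT /\ finite_set t].
have Cc : countable C.
  apply: countableX => //; apply: countable_finite_subset.
  apply: (countable_sub _ (countable_malg (countableP [set: seq bool])
    (countableP [set: int]))).
  by move=> h _ k.
have typC n u : C (n, typ n u).
  by split=> //; split=> //; exact/finite_image/finite_fset.
pose K (p : nat * set {malg int[seq bool]}) := B `&` [set u | typ p.1 u = p.2].
(* Members whose type recurs uncountably often at every level. As there are countably many types,
   only countably many members are lost. *)
pose B1 := [set u | B u /\ forall n, ~ countable (K (n, typ n u))].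
have BB1 : countable (B `\` B1).
  apply: (@countable_sub _ _ (\bigcup_(p in C `&` [set p | countable (K p)]) K p)).
    move=> u [Bu nB1]; have [n nu] : exists n, countable (K (n, typ n u)).
      by apply: contrapT => nn; apply: nB1; split=> // n ?; apply: nn; exists n.
    by exists (n, typ n u).
  apply: bigcup_countable => [|p []//].
  by apply: (countable_sub _ Cc) => p [].
(* [U (p, x)] is a member of type [p] with tail above [x]; [F x] will bound the indices of all of
   these at once. *)
have /choice[U UP] : forall p : (nat * set {malg int[seq bool]}) * I, exists u,
    ~ countable (K p.1) -> K p.1 u /\
      forall i, i \in indices u -> i \notin R -> (p.2 < i)%O.
  move=> [p x]; have [Kc|Kunc] := pselect (countable (K p)); first by exists 0.
  have [u Ku ux] : exists2 u, K p u & forall i, i \in indices u -> i \notin R -> (x < i)%O.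
    by apply: tail_above hom _ Kunc => u [].
  by exists u.
have /choice[F FP] : forall x, exists y, forall p, C p ->
    forall i, i \in indices (U (p, x)) -> (i < y)%O.
  move=> x; have [y yP] := countable_bounded I_seg I_unc
    (bigcup_countable Cc (fun p _ => countable_fset (indices (U (p, x))))).
  by exists y => p Cp i iu; apply: yP; exists p.
(* The label needed is known only once [b] is chosen, and [b] must lie above [d]. So [F2] bounds the
   ordinals [D (x, a)] for all labels, and [d] is closed under [F2]. *)
have /choice[D DP] : forall p : I * option (nat * code_type * code_type), exists x,
    [/\ l x = p.2, (p.1 < x)%O & forall i, (i < x)%O -> (F i < x)%O].
  by move=> [x a]; exact: l_stat.
have /choice[F2 F2P] : forall x, exists y, forall a, (D (x, a) < y)%O.
  move=> x; have [y yP] := countable_bounded I_seg I_unc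
    (card_le_trans (card_image_le (fun a => D (x, a)) setT) (countableP _)).
  by exists y => a; apply: yP; exists a.
have [iR iRP] := countable_bounded I_seg I_unc (countable_fset R).
have [d iRd dF2] := closed_point I_wf I_seg I_unc F2 iR.
have B1unc : ~ countable B1.
  move=> B1c; apply: (hom_unc hom).
  apply: (countable_sub _ (countable_setU B1c BB1)) => u Bu.
  by have [?|?] := pselect (B1 u); [left|right].
have [b [[Bb bbig] bR] bd] : exists2 b,
    (B1 `\` [set u | forall i, i \in indices u -> i \in R]) b &
    forall i, i \in indices b -> i \notin R -> (d < i)%O.
  apply: (tail_above _ hom); first by move=> u [[]].
  by apply: uncountable_setD => //; exact/countable_indices/countable_fset.
have [h1 h1b h1R] : exists2 h, h \in msupp b & ~~ (msupp h `<=` R)%fset.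
  apply: contrapT => noh; apply: bR => i /indicesP[h hb ih].
  have [hR|hR] := boolP (msupp h `<=` R)%fset; first exact: (fsubsetP hR).
  by case: noh; exists h.
pose Q := (indices b `|` R)%fset.
have RQ : (R `<=` Q)%fset by exact: fsubsetUr.
have Qsep : {in Q &, injective (pre n0)} by exact: hom_sep hom _ Bb.
have Qtail j : j \in Q -> j \notin R -> (d < j)%O.
  by rewrite in_fsetU => /orP[|->//]; exact: bd.
have bQ h : h \in msupp b -> inQ Q h.
  by move=> hb i ih; rewrite in_fsetU; apply/orP; left; apply/indicesP; exists h.
pose E n := \bigcup_(j in [set` Q]) [set x | (x <= j)%O /\ (e j x <= n)%N].
have Efin n : finite_set (E n).
  apply: bigcup_finite => [|j _]; [exact: finite_fset|exact: finite_e].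
have [x0 [iRx0 x0d x0E]] := finite_bound_below (Efin n0) iRd.
have Rhead i : i \in R -> (i <= x0)%O.
  by move=> /iRP/ltW iiR; exact: le_trans iiR iRx0.
have x0P j x : j \in Q -> (x <= j)%O -> (e j x <= n0)%N -> (x < d)%O -> (x <= x0)%O.
  by move=> jQ xj ejx; apply: x0E; exists j.
have cR : forall i, i \in msupp c -> i \in R.
  by move=> i; rewrite msuppU oner_eq0 inE => /eqP->.
pose pairs := [seq p <- [seq (g, h) | g <- msupp b, h <- msupp b] |
  (tl d p.1 == tl d p.2) && (tl d p.2 != 0)].
have [[g0 h0]] : exists2 p, p \in pairs &
    forall q, q \in pairs -> ~ pos ((q.2 - q.1) - (p.2 - p.1)).
  (* The diagonal pair [(h1, h1)] shows that there is something to maximize over. *)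
  apply: (@pos_maximal _ _ _ (fun q : H * H => q.2 - q.1) pairs (h1, h1)).
  rewrite mem_filter eqxx (tl_neq0 Qtail Rhead x0d (bQ _ h1b)) h1R /=.
  by apply/allpairsP; exists (h1, h1).
rewrite mem_filter /= => /andP[/andP[/eqP tl00 tlh0]].
move=> /allpairsP[[g h] /= [g0b h0b [eg eh]]] pmax; subst g h.
have maxP g h : g \in msupp b -> h \in msupp b -> tl d g = tl d h ->
    tl d h != 0 -> ~ pos ((h - g) - (h0 - g0)).
  move=> gb hb tlgh tlh; apply: (pmax (g, h)); rewrite mem_filter /= tlgh eqxx tlh /=.
  by apply/allpairsP; exists (g, h).
(* The pattern of the maximal pair becomes the label of [d1], while [d2] carries no pattern. *)
pose lam := Some (n0, code (pi n0 (cut d h0 + c - g0)), code (pi n0 (tl d h0))).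
have [ld1 x0d1 d1F] := DP (x0, lam); set d1 := D (x0, lam) in ld1 x0d1 d1F.
have [ld2 x0d2 d2F] := DP (x0, None); set d2 := D (x0, None) in ld2 x0d2 d2F.
have d1d : (d1 < d)%O by exact: lt_trans (F2P x0 lam) (dF2 _ x0d).
have d2d : (d2 < d)%O by exact: lt_trans (F2P x0 None) (dF2 _ x0d).
pose level x := if l x is Some (n, _, _) then n else 0%N.
(* [n1] bounds the [e]-values of the two landing ordinals and the levels of all labels that an
   unmatched pair can meet. *)
have [n1 n1P] : exists n1, forall k,
   ([set n0] `|` (e^~ d1 @` [set` Q]) `|` (e^~ d2 @` [set` Q]) `|` (level @` E n0)) k ->
   (k <= n1)%N.
  by apply: nat_bound; rewrite !finite_setU; do !split;
    try exact: finite_set1; apply: finite_image => //; exact: finite_fset.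
have n01 : (n0 <= n1)%N by apply: n1P; do 3 left.
have ed1 j : j \in Q -> (e j d1 <= n1)%N by move=> jQ; apply: n1P; left; left; right; exists j.
have ed2 j : j \in Q -> (e j d2 <= n1)%N by move=> jQ; apply: n1P; left; right; exists j.
have l_le1 j x n p q : j \in Q -> (x <= j)%O -> (e j x <= n0)%N ->
    l x = Some (n, p, q) -> (n <= n1)%N.
  move=> jQ xj ejx lx; apply: n1P; right; exists x; first by exists j.
  by rewrite /level lx.
(* [b'] only serves to bound the [delta i j] by [m] before [a] and [a'] are chosen. *)
have [iQ iQP] := countable_bounded I_seg I_unc (countable_fset Q).
have [b' [Kb' B1b'] b'iQ] : exists2 b', (K (n1, typ n1 b) `\` (B `\` B1)) b' &
    forall i, i \in indices b' -> i \notin R -> (iQ < i)%O.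
  apply: (tail_above _ hom); first by move=> u [[]].
  exact: uncountable_setD.
have {}B1b' : B1 b' by apply: contrapT => nB1; apply: B1b'; split=> //; exact: Kb'.1.
have [m mP] : exists m, forall k, ([set n1] `|`
    [set delta r i j | i in [set` indices b'] & j in [set` Q]]) k -> (k < m)%N.
  have [|m mP] := @nat_bound ([set n1] `|`
    [set delta r i j | i in [set` indices b'] & j in [set` Q]]).
    rewrite finite_setU; split; first exact: finite_set1.
    by apply: finite_image2; exact: finite_fset.
  by exists m.+1 => k /mP.
have n1m : (n1 <= m)%N by apply/ltnW/mP; left.
have n0m := leq_trans n01 n1m.
(* Below [d'], ordinals of [e]-value at most [m] end at [x']. Since [d'] is closed under [F], a
   member with the level [m] type of [b'] has its tail between [x'] and [d']. *)
have pick d' : (x0 < d')%O -> (forall i, (i < d')%O -> (F i < d')%O) -> (d' < d)%O ->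
    (forall j, j \in Q -> (e j d' <= n1)%N) -> exists a x', [/\ B a, typ m a = typ m b' &
      forall g, g \in msupp a -> side r e R Q n0 n1 m d x0 g d' x'].
  move=> x0d' d'F d'd ed'.
  have [x' [x0x' x'd' x'E]] := finite_bound_below (Efin m) x0d'.
  have [[Ba ta] atail] := UP ((m, typ m b'), x') (B1b'.2 m).
  set a := U _ in Ba ta atail.
  have {}ta : typ m a = typ m b' by [].
  have ad' i : i \in indices a -> (i < d')%O.
    by move=> ia; apply: lt_trans (FP x' _ (typC m b') i ia) (d'F _ x'd').
  have asep := hom_sep hom Ba.
  have twin n u i : (n0 <= n)%N -> typ n a = typ n u -> i \in indices a -> i \notin R ->
      exists2 i', i' \in indices u & i' \notin R /\ pre n i = pre n i'.
    move=> n0n tau ia iR'; have /indicesP[g ga ig] := ia.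
    have [g' g'u gg'] : typ n u (pi n g) by rewrite -tau; exists g.
    have : (pi n g)@_(pre n i) != 0.
      rewrite /pi push_coef_inj ?mcoeff_neq0 // => k kg /(pre_le n0n).
      apply: asep; rewrite in_fsetU; apply/orP; left => //.
      by apply/indicesP; exists g.
    rewrite -gg' => /push_supp[i' i'g prii'].
    exists i'; first by apply/indicesP; exists g'.
    split=> //; apply: contra iR' => i'R; suff -> : i = i' by [].
    apply: asep; rewrite ?in_fsetU ?ia ?i'R ?orbT //.
    exact/esym/(pre_le n0n).
  exists a, x'; split=> // g ga.
  have gi i : i \in msupp g -> i \in indices a by move=> ig; apply/indicesP; exists g.
  split=> //.
  - by move=> i ig iR'; rewrite atail ?ad' ?gi.
  - move=> i j; rewrite !in_fsetU => ig jg; apply: asep; rewrite in_fsetU.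
      by case/orP: ig => [/gi->|->]; rewrite ?orbT.
    by case/orP: jg => [/gi->|->]; rewrite ?orbT.
  - move=> i j ig iR' jQ jR.
    have [i' i'b' [i'R prii']] := twin m b' i n0m ta (gi i ig) iR'.
    have dm : (delta r i' j < m)%N by apply: mP; right; exists i' => //; exists j.
    rewrite (delta_pre r_inj _ _ prii' dm) //.
      by rewrite lt_eqF // (lt_trans (ad' i (gi i ig))) // (lt_trans d'd) // Qtail.
    by rewrite gt_eqF // (lt_trans (iQP j jQ)) // b'iQ.
  - by move=> j x jQ xj ejx; apply: x'E; exists j.
  - move=> i ig iR'; have tab : typ n1 a = typ n1 b.
      rewrite -[RHS]Kb'.2; apply/seteqP; split=> _ [g1 g1u <-].
        have [g2 g2u e12] : typ m b' (pi m g1) by rewrite -ta; exists g1.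
        by exists g2 => //; exact: pi_le n1m e12.
      have [g2 g2u e12] : typ m a (pi m g1) by rewrite ta; exists g1.
      by exists g2 => //; exact: pi_le n1m e12.
    have [j jb jP] := twin n1 b i n01 tab (gi i ig) iR'.
    by exists j => //; rewrite in_fsetU jb.
have [a [x1 [Ba ta Sa]]] := pick d1 x0d1 d1F d1d ed1.
have [a' [x2 [Ba' ta' Sa']]] := pick d2 x0d2 d2F d2d ed2.
have tb : typ n1 b' = typ n1 b := Kb'.2.
have typE n u u' g : typ n u = typ n u' -> g \in msupp u ->
    exists2 g', g' \in msupp u' & pi n g = pi n g'.
  move=> tuu' gu; have [g' g'u e'] : typ n u' (pi n g) by rewrite -tuu'; exists g.
  by exists g'.
have typE1 g : g \in msupp a -> exists2 g', g' \in msupp b & pi n1 g = pi n1 g'.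
  move=> /(typE _ _ _ _ ta)[g1 g1b /(pi_le n1m) ->].
  exact: typE tb g1b.
have typE2 g : g \in msupp b -> exists2 g', g' \in msupp a & pi n1 g' = pi n1 g.
  move=> /(typE _ _ _ _ (esym tb))[g1 g1b ->].
  have [g2 g2a e2] := typE _ _ _ _ (esym ta) g1b.
  by exists g2 => //; exact/esym/(pi_le n1m).
have inj u : B u -> {in msupp u &, injective (pi n0)}.
  move=> Bu g g' gu g'u; apply: (push_inj (P := [set` (indices u `|` R)%fset])).
  - by move=> i j /set_mem iu /set_mem ju; exact: (hom_sep hom Bu).
  - by move=> i ig /=; rewrite in_fsetU; apply/orP; left; apply/indicesP; exists g.
  - by move=> i ig /=; rewrite in_fsetU; apply/orP; left; apply/indicesP; exists g'.
have : comm psi a (act c false b) + comm psi a' (act c false b) = 1.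
  apply: (comm_pair_sum r_inj RQ Qsep Qtail Rhead x0d cR x0P n01 n1m _ (posU i0) bQ
    g0b h0b tl00 tlh0 maxP ld1 Sa Sa' ld2 (inj _ Ba) (inj _ Ba') _ _ typE1 _ (hom_restr hom Bb)).
  - by move=> j x n p q jQ xj ejx lx; apply: leq_trans (l_le1 j x n p q jQ xj ejx lx) n1m.
  - by move=> g; apply: typE; rewrite ta ta'.
  - move=> g' /(typE m a' a); rewrite ta ta' => /(_ erefl)[g ga gg'].
    by exists g.
  - by move=> g' /typE2[g ga gg']; exists g.
  - exact: (hom_comm hom).
case: (F2_cases (comm psi a (act c false b))) => [->|a1 _].
  by rewrite add0r => a'1; exists a', b; split; [exact: BA|exact: BA|].
by exists a, b; split; [exact: BA|exact: BA|].
Qed.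

End Family.

(** * Construction of omega_1 and conclusion *)

Lemma uncountable_cantor : ~ countable [set: nat -> bool].
Proof.
move=> /countable_injP[f finj].
pose g n := ~~ `[< exists t, f t = n /\ t n >].
have gE n : g n <-> ~ (exists t, f t = n /\ t n) by split=> /asboolPn.
have [gg|ng] := pselect (g (f g)); first by case: ((gE (f g)).1 gg); exists g.
apply: (ng); apply/gE => -[t [ft tf]]; apply: (ng).
by move: tf; rewrite (finj _ _ (mem_set Logic.I) (mem_set Logic.I) ft).
Qed.

(** Apply the existence of a unique minimum to sets of two and three elements. *)
Lemma well_order_props (T : eqType) (R : rel T) : well_order R ->
  [/\ reflexive R, antisymmetric R, transitive R & total R].
Proof.
move=> Rwo.
have Rtot : total R.
  move=> x y; have [] := Rwo [pred z | (z == x) || (z == y)].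
    by exists x; rewrite inE eqxx.
  move=> z [[zxy zmin] _]; move: zxy; rewrite inE => /orP[]/eqP zE.
    by rewrite -zE zmin // inE eqxx orbT.
  by rewrite -zE zmin ?orbT // inE eqxx.
have Rrefl : reflexive R by move=> x; have := Rtot x x; rewrite orbb.
have Ranti : antisymmetric R.
  move=> x y /andP[xy yx]; have [] := Rwo [pred z | (z == x) || (z == y)].
    by exists x; rewrite inE eqxx.
  move=> z [_ zu]; rewrite -(zu x) ?(zu y) //; split; rewrite ?inE ?eqxx ?orbT //.
    by move=> t; rewrite inE => /orP[]/eqP->.
  by move=> t; rewrite inE => /orP[]/eqP->.
split=> // y x z xy yz; have [] := Rwo [pred t | [|| t == x, t == y | t == z]].
  by exists x; rewrite inE eqxx.
move=> t [[txyz tmin] _]; move: txyz; rewrite inE => /or3P[]/eqP tE.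
- by rewrite -tE tmin // inE eqxx !orbT.
- have tx : t = x by apply: Ranti; rewrite tmin ?inE ?eqxx // tE xy.
  by rewrite -tx tmin // inE eqxx !orbT.
have ty : t = y by apply: Ranti; rewrite tmin ?inE ?eqxx ?orbT // tE yz.
by rewrite -tE ty.
Qed.

(** Well-order the Cantor space and take the first uncountable initial segment, or everything if all
    of them are countable; [r] is the inclusion. *)
Lemma omega1_exists : exists (disp : Order.disp_t) (I : orderType disp)
    (r : I -> nat -> bool),
  [/\ injective r,
      forall A : set I, A !=set0 -> exists2 m, A m & forall i, A i -> (m <= i)%O,
      forall i : I, countable [set j : I | (j < i)%O] & ~ countable [set: I]].
Proof.
pose T : choiceType := nat -> bool.
have [R Rwo] := well_ordering_principle T.
have [Rrefl Ranti Rtrans Rtot] := well_order_props Rwo.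
pose below x := [set y : T | R y x && (y != x)].
have [p [punc pc]] : exists p : pred T, ~ countable [set x | p x] /\
    forall x, p x -> countable (below x `&` [set y | p y]).
  have [[x xunc]|allc] := pselect (exists x, ~ countable (below x)).
    have [|m [[mP mmin] _]] := Rwo [pred x | `[< ~ countable (below x) >]].
      by exists x; rewrite inE; exact/asboolP.
    exists (fun y => R y m && (y != m)); split.
      by move: mP; rewrite inE => /asboolP.
    move=> y /andP[ym yNm]; apply: contrapT => yunc.
    have : R m y.
      apply: mmin; rewrite inE; apply/asboolP; apply: contra_not yunc.
      by apply: countable_sub => z [].
    by move=> my; case/eqP: yNm; apply: Ranti; rewrite ym.
  exists predT; split=> [|x _].
    by apply: contra_not uncountable_cantor; exact: countable_sub.
  apply: contrapT => xunc; apply: allc; exists x; apply: contra_not xunc.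
  by apply: countable_sub => z [].
pose S : choiceType := {x : T | p x}.
pose le : rel S := fun x y => R (val x) (val y).
have le_refl : reflexive le by move=> x; exact: Rrefl.
have le_anti : antisymmetric le by move=> x y /Ranti/val_inj.
have le_trans : transitive le by move=> y x z; exact: Rtrans.
have le_total : total le by move=> x y; exact: Rtot.
pose disp := Order.Disp tt tt.
pose P : porderType disp :=
  HB.pack S (Order.Le_isPOrder.Build disp S le_refl le_anti le_trans).
pose I : orderType disp := HB.pack (P : Type) (Order.POrder.class P)
  (Order.POrder_isTotal.Build disp P le_total).
exists disp, I, (fun i => val (i : S)); split.
- exact: val_inj.
- move=> A [i Ai].
  have [|x [[xA xmin] _]] := Rwo [pred x | `[< exists2 i : S, A i & val i = x >]].
    by exists (val (i : S)); rewrite inE; apply/asboolP; exists i.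
  move: xA; rewrite inE => /asboolP[m Am mx]; exists m => // j Aj.
  by rewrite -[(_ <= _)%O]/(R _ _) mx; apply: xmin; rewrite inE; apply/asboolP; exists j.
- move=> i; pose f (j : I) : T := val (j : S).
  have finj : {in [set j : I | (j < i)%O] &, injective f} by move=> ? ? _ _ /val_inj.
  rewrite -(eq_countable (inj_card_eq finj)).
  apply: (countable_sub _ (pc (val (i : S)) (valP (i : S)))) => _ [j /= ji <-].
  have /andP[ij jNi] : (j <= i)%O && (j != i) by rewrite lt_neqAle andbC in ji.
  by split; [apply/andP; split|exact: (valP (j : S))].
- apply: contra_not punc => Sc; pose f (j : I) : T := val (j : S).
  apply: (countable_sub _ (card_le_trans (card_image_le f setT) Sc)) => x px.
  by exists (exist _ x px : S).
Qed.

(** Order by rank, then by an enumeration of the fibre. A proper initial segment meets only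
    countably many fibres, each of them countable. *)
Lemma size_aleph1_rank (disp : Order.disp_t) (I : orderType disp) (T : choiceType)
    (rank : T -> I) :
  (forall A : set I, A !=set0 -> exists2 m, A m & forall i, A i -> (m <= i)%O) ->
  (forall i : I, countable [set j : I | (j < i)%O]) ->
  (forall i, countable [set t | rank t = i]) -> ~ countable [set: T] ->
  has_size_aleph1 T.
Proof.
move=> I_wf I_seg rankc Tunc; split=> //.
have /choice[n nP] : forall i, exists n : T -> nat,
    {in [set t | rank t = i] &, injective n}.
  by move=> i; exact/countable_injP.
have n_inj t u : rank t = rank u -> n (rank t) t = n (rank t) u -> t = u.
  by move=> tu; apply: nP; exact: mem_set.
pose R : rel T := fun t u => (rank t < rank u)%O ||
  (rank t == rank u) && (n (rank t) t <= n (rank t) u)%N.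
exists R; split=> [A [t0 At0]|t].
  have [|i [t /= [At rt]] imin] := I_wf [set rank t | t in [set t | t \in A]].
    by exists (rank t0), t0.
  pose P k := `[< exists t, [/\ t \in A, rank t = i & n i t = k] >].
  have exP : exists k, P k by exists (n i t); apply/asboolP; exists t.
  case: (ex_minnP exP) => k /asboolP[u [Au ru nu]] kmin.
  have umin v : v \in A -> R u v.
    move=> Av; rewrite /R ru nu.
    have : (i <= rank v)%O by apply: imin; exists v.
    rewrite le_eqVlt => /orP[/eqP iv|->//]; rewrite iv eqxx ltxx /=; apply: kmin.
    by apply/asboolP; exists v; rewrite -iv.
  exists u; split; first by split=> // v; exact: umin.
  move=> v [Av vmin]; have := vmin _ Au; have := umin _ Av.
  rewrite /R; case: ltgtP => //= e n1 n2; apply: n_inj => //.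
  by apply/eqP; rewrite eqn_leq n1 e n2.
apply: (@countable_sub _ _ (\bigcup_(i in [set i | (i <= rank t)%O]) [set u | rank u = i])).
  move=> u /andP[/orP ut _]; exists (rank u) => //=.
  by case: ut => [/ltW//|/andP[/eqP-> _]].
by apply: bigcup_countable => [|i _]; [exact: countable_le|exact: rankc].
Qed.

Lemma uncountable_inj (S T : Type) (f : S -> T) :
  injective f -> ~ countable [set: S] -> ~ countable [set: T].
Proof.
move=> finj; apply: contra_not => Tc.
have finj' : {in [set: S] &, injective f} by move=> ? ? _ _; exact: finj.
by rewrite -(eq_countable (inj_card_eq finj')); exact: countable_sub Tc.
Qed.

(** * Cardinality of the group *)

Section Rank.
Variables (disp : Order.disp_t) (I : orderType disp).
Hypothesis I_wf : forall A : set I, A !=set0 ->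
  exists2 m, A m & forall i, A i -> (m <= i)%O.
Hypothesis I_seg : forall i : I, countable [set j : I | (j < i)%O].
Hypothesis I_unc : ~ countable [set: I].
Variable psi : {malg int[I]} -> 'F_2.

(** The rank bounds all indices occurring in an element, so countably many elements share a rank. *)
Lemma skew_aleph1 : has_size_aleph1 (skew psi).
Proof.
have /choice[rank rankP] : forall u : skew psi, exists i,
    forall j, j \in (indices (sx u) `|` msupp (sh u))%fset -> (j < i)%O.
  by move=> u; apply: countable_bounded => //; exact: countable_fset.
apply: (size_aleph1_rank (rank := rank)) => // [i|].
  have Ic := I_seg i.
  have Hc := countable_malg Ic (countableP [set: int]).
  have Xc := countable_indices Ic.
  have tinj : {in [set u : skew psi | rank u = i] &, injective (@skew_tuple _ psi)}.
    by move=> u v _ _; exact: (can_inj (@skew_tupleK _ psi)).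
  rewrite -(eq_countable (inj_card_eq tinj)).
  apply: (countable_sub _ (countableX (countableX (countableX Xc
    (countableP [set: 'F_2])) Hc) (countableP [set: bool]))).
  move=> _ [u /= <- <-]; split=> //; split=> [|j ju]; first split=> // j ju.
    by apply: rankP; rewrite in_fsetU ju.
  by apply: rankP; rewrite in_fsetU ju orbT.
apply: (@uncountable_inj _ _ (fun i => tr psi << i >>)) I_unc => i j.
by move=> /(congr1 (fun u : skew psi => sh u)) /=; exact: malgU_inj.
Qed.

End Rank.

Theorem theorem1p19 :
  exists G : groupType,
    [/\ has_size_aleph1 G,
        is_discrete (FM_topology G) &
        ~ is_discrete (zariski_topology G)].
Proof.
have [disp [I [r [r_inj I_wf I_seg I_unc]]]] := omega1_exists.
have [e e_inj] := seg_injections I_seg.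
have [l l_stat] := stationary_partition I_wf I_seg I_unc e_inj
  (None : option (nat * code_type * code_type)).
have [i0 _] := uncountable_nonempty I_unc.
have Hunc : ~ countable [set: {malg int[I]}].
  by apply: (@uncountable_inj _ _ (fun i => << i >>)) I_unc => i j; exact: malgU_inj.
exists (skew (psi r e l)); split.
- exact: skew_aleph1.
- apply: (@skew_FM_discrete _ _ << i0 >>) => //.
    apply/eqP => /(congr1 (fun h : {malg int[I]} => h@_i0)).
    by rewrite mcoeffD mcoeffUU mcoeff0.
  move=> A Aunc.
  exact: (anticommuting I_wf I_seg I_unc r_inj e_inj l_stat i0 Aunc).
- apply: skew_zariski_not_discrete => /finite_set_countable.
  apply: (@uncountable_inj _ _ (fun h : {malg int[I]} => << h >>)) Hunc => g h.
  exact: malgU_inj.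
Qed.
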